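(* Let $\mathcal{M}$ be a smooth connected manifold. For $\mathrm{g}\in\mathrm{Met}(\mathcal{M})$ and $B\in\mathrm{Ell}_{\mathrm{loc}}(\mathcal{M})$ set $\mathrm{g}_B(x)[u,v]:=\mathrm{g}(x)[B(x)u,B(x)v]$. Then: (i) for $B\in\mathrm{Ell}_{\mathrm{loc}}(\mathcal{M})$ and $\mathrm{g}\in\mathrm{Met}(\mathcal{M})$, we have $\mathrm{g}_B\in\mathrm{Met}(\mathcal{M})$; (ii) the map $\eta:\mathrm{Ell}_{\mathrm{loc}}(\mathcal{M})\times\mathrm{Met}(\mathcal{M})\to\mathrm{Met}(\mathcal{M})$ given by $(B,\mathrm{g})\mapsto\eta(B)\mathrm{g}=\mathrm{g}_B$ is a group action of $\mathrm{Ell}_{\mathrm{loc}}(\mathcal{M})$ on $\mathrm{Met}(\mathcal{M})$; (iii) given any $\mathrm{g},\mathrm{h}\in\mathrm{Met}(\mathcal{M})$, there exists $B\in\mathrm{Ell}_{\mathrm{loc}}(\mathcal{M})$ such that $\mathrm{g}=\eta(B)\mathrm{h}$.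
   Context: $\mathcal{M}$ carries a smooth differentiable structure and has no boundary. A set $Z\subset\mathcal{M}$ has measure zero if its image in every smooth chart has Lebesgue measure zero; ''almost every'' (a.e.) refers to this notion. Measurable sections agreeing a.e. are identified. A rough Riemannian metric on $\mathcal{M}$ is a measurable symmetric $(2,0)$-tensor field $\mathrm{g}$ (a measurable section of symmetric bilinear forms on $T\mathcal{M}$) such that for every $x\in\mathcal{M}$ there is a chart $(U,\psi)$ near $x$ and a constant $C_U\ge 1$ with $C_U^{-1}|u|_{\psi^*\delta(y)}\le |u|_{\mathrm{g}(y)}\le C_U|u|_{\psi^*\delta(y)}$ for almost every $y\in U$ and all $u\in T_yU$. Here $|u|_{\mathrm{g}(y)}=\sqrt{\mathrm{g}(y)[u,u]}$ and $\delta$ is the Euclidean metric. $\mathrm{Met}(\mathcal{M})$ is the set of all rough Riemannian metrics on $\mathcal{M}$. $L^\infty_{\mathrm{loc}}(\mathcal{M};\mathrm{End}(T\mathcal{M}))$ is the set of measurable sections of $\mathrm{End}(T\mathcal{M})$ that are essentially bounded on every compact $K\subset\mathcal{M}$ with respect to a smooth metric on $K$ (this is independent of the choice of the smooth metric). Define $$\mathrm{Ell}_{\mathrm{loc}}(\mathcal{M})=\{B\in L^\infty_{\mathrm{loc}}(\mathcal{M};\mathrm{End}(T\mathcal{M})): B^{-1}\in L^\infty_{\mathrm{loc}}(\mathcal{M};\mathrm{End}(T\mathcal{M}))\},$$ where $B^{-1}$ is the pointwise a.e. inverse. $\mathrm{Ell}_{\mathrm{loc}}(\mathcal{M})$ is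 a group under pointwise composition on fibres. *)

(* Defs.v *)
From HB Require Import structures.
From Stdlib Require Import RelationClasses.
From mathcomp Require Import all_boot all_order all_algebra.
From mathcomp Require Import all_classical all_reals all_analysis.
Set Implicit Arguments.
Unset Strict Implicit.
Unset Printing Implicit Defensive.
Import Order.TTheory GRing.Theory Num.Theory.
Import numFieldNormedType.Exports.
Local Open Scope classical_set_scope.
Local Open Scope ring_scope.

(* {1 Lebesgue null sets, Lebesgue measurability and smoothness on R^n} *)

Definition box (R : realType) (n : nat) (a b : 'rV[R]_n) : set 'rV[R]_n :=
  [set x | forall i, a 0 i <= x 0 i <= b 0 i].

(* The index set [D] may be empty: for n = 0 every box has volume 1, and only
   the empty family covers the empty set with small total volume. *)
Definition lebesgue_null (R : realType) (n : nat) (A : set 'rV[R]_n) : Prop :=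
  forall e : R, 0 < e ->
  exists (D : set nat) (a b : nat -> 'rV[R]_n),
    [/\ forall k, D k -> forall i, a k 0 i <= b k 0 i,
        A `<=` \bigcup_(k in D) box (a k) (b k) &
        (\esum_(k in D) (\prod_i (b k 0 i - a k 0 i))%:E <= e%:E)%E].

(* The Lebesgue sigma-algebra of R^n is the completion of the Borel one: it is
   generated by the open sets and the null sets. *)
Definition lebesgue_gen (R : realType) (n : nat) : set (set 'rV[R]_n) :=
  [set A | open A \/ lebesgue_null A].

Definition lebesgue_measurable_fun (R : realType) (n : nat)
    (D : set 'rV[R]_n) (f : 'rV[R]_n -> R) : Prop :=
  measurable_fun (D : set (g_sigma_algebraType (@lebesgue_gen R n))) f.

Fixpoint Ck_on (R : realType) (V W : normedModType R) (k : nat) (U : set V)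
    (f : V -> W) : Prop :=
  match k with
  | 0 => forall x, U x -> {for x, continuous f}
  | k'.+1 => (forall x, U x -> differentiable f x) /\
             (forall v : V, Ck_on k' U ('D_v f))
  end.

(* Meant for an open set [U]; the values of [f] outside [U] play no role. *)
Definition smooth_on (R : realType) (V W : normedModType R) (U : set V)
    (f : V -> W) : Prop :=
  forall k, Ck_on k U f.

(* {1 Smooth manifolds} *)

(* [cinv] is only meaningful on the image [cmap @` dom]. *)
Record chart (R : realType) (n : nat) (T : topologicalType) := Chart {
  dom : set T;
  cmap : T -> 'rV[R]_n;
  cinv : 'rV[R]_n -> T;
  dom_open : open dom;
  img_open : open (cmap @` dom);
  cmapK : forall x, dom x -> cinv (cmap x) = x;
  cmap_continuous : forall x, dom x -> {for x, continuous cmap};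
  cinv_continuous : forall p, (cmap @` dom) p -> {for p, continuous cinv}
}.

Definition smooth_transition (R : realType) (n : nat) (T : topologicalType)
    (phi psi : chart R n T) : Prop :=
  smooth_on (cmap phi @` (dom phi `&` dom psi)) (cmap psi \o cinv phi).

Definition compatible (R : realType) (n : nat) (T : topologicalType)
    (phi psi : chart R n T) : Prop :=
  smooth_transition phi psi /\ smooth_transition psi phi.

Record smoothManifold (R : realType) (n : nat) := SmoothManifold {
  carrier :> topologicalType;
  carrier_hausdorff : hausdorff_space carrier;
  carrier_second_countable : @second_countable carrier;
  atlas : set (chart R n carrier);
  atlas_cover : forall x, exists phi, atlas phi /\ dom phi x;
  atlas_compatible : forall phi psi,
    atlas phi -> atlas psi -> compatible phi psi
}.

(* The charts of the maximal atlas. *)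
Definition smooth_chart (R : realType) (n : nat) (M : smoothManifold R n)
    (phi : chart R n M) : Prop :=
  forall psi, @atlas R n M psi -> compatible phi psi.

Definition chart_at (R : realType) (n : nat) (M : smoothManifold R n) (x : M) :
    chart R n M :=
  projT1 (cid (atlas_cover x)).

(* A tangent vector at [x] is represented by its coordinates in the chosen
   chart [chart_at x]; coordinates in any other chart are obtained through the
   differentials of the transition maps, see [dchart] and [dchart_inv]. *)
Definition tangent (R : realType) (n : nat) (M : smoothManifold R n) (x : M) :
  Type := 'rV[R]_n.

HB.instance Definition _ (R : realType) (n : nat) (M : smoothManifold R n)
  (x : M) := Vector.copy (@tangent R n M x) 'rV[R]_n.

(* d(phi)_x : T_x M -> R^n *)
Definition dchart (R : realType) (n : nat) (M : smoothManifold R n)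
    (phi : chart R n M) (x : M) (u : tangent x) : 'rV[R]_n :=
  'd (cmap phi \o cinv (chart_at x)) (cmap (chart_at x) x) (u : 'rV[R]_n).

(* The inverse R^n -> T_x M of d(phi)_x. *)
Definition dchart_inv (R : realType) (n : nat) (M : smoothManifold R n)
    (phi : chart R n M) (x : M) (w : 'rV[R]_n) : tangent x :=
  'd (cmap (chart_at x) \o cinv phi) (cmap phi x) w.

(* The i-th coordinate vector field of [phi] at [x]. *)
Definition coord_vector (R : realType) (n : nat) (M : smoothManifold R n)
    (phi : chart R n M) (x : M) (i : 'I_n) : tangent x :=
  dchart_inv phi x (delta_mx 0 i).

Definition null_set (R : realType) (n : nat) (M : smoothManifold R n)
    (Z : set M) : Prop :=
  forall phi : chart R n M, smooth_chart phi ->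
    lebesgue_null (cmap phi @` (Z `&` dom phi)).

Definition ae_on (R : realType) (n : nat) (M : smoothManifold R n)
    (A : set M) (P : M -> Prop) : Prop :=
  null_set [set x | A x /\ ~ P x].

Definition ae (R : realType) (n : nat) (M : smoothManifold R n)
    (P : M -> Prop) : Prop :=
  ae_on setT P.

(* {1 Sections of End(TM) and (2,0)-tensor fields} *)

(* Sections are represented by everywhere defined ones and compared with
   [endo_ae_eq] and [form_ae_eq]. *)
Definition endo_section (R : realType) (n : nat) (M : smoothManifold R n) :=
  forall x : M, 'End(tangent x).

Definition form_section (R : realType) (n : nat) (M : smoothManifold R n) :=
  forall x : M, tangent x -> tangent x -> R.

Definition endo_ae_eq (R : realType) (n : nat) (M : smoothManifold R n)
    (A B : endo_section M) : Prop :=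
  ae (fun x : M => A x = B x).

Definition form_ae_eq (R : realType) (n : nat) (M : smoothManifold R n)
    (g h : form_section M) : Prop :=
  ae (fun x : M => forall u v : tangent x, g x u v = h x u v).

Definition endo_coef (R : realType) (n : nat) (M : smoothManifold R n)
    (B : endo_section M) (phi : chart R n M) (i j : 'I_n) (p : 'rV[R]_n) : R :=
  dchart phi (B (cinv phi p) (coord_vector phi (cinv phi p) i)) 0 j.

Definition form_coef (R : realType) (n : nat) (M : smoothManifold R n)
    (g : form_section M) (phi : chart R n M) (i j : 'I_n) (p : 'rV[R]_n) : R :=
  g (cinv phi p) (coord_vector phi (cinv phi p) i)
    (coord_vector phi (cinv phi p) j).

Definition measurable_endo (R : realType) (n : nat) (M : smoothManifold R n)
    (B : endo_section M) : Prop :=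
  forall phi : chart R n M, smooth_chart phi -> forall i j,
    lebesgue_measurable_fun (cmap phi @` dom phi) (endo_coef B phi i j).

Definition measurable_form (R : realType) (n : nat) (M : smoothManifold R n)
    (g : form_section M) : Prop :=
  forall phi : chart R n M, smooth_chart phi -> forall i j,
    lebesgue_measurable_fun (cmap phi @` dom phi) (form_coef g phi i j).

(* By symmetry, linearity in the second argument suffices. *)
Definition symmetric_bilinear (R : realType) (n : nat) (M : smoothManifold R n)
    (g : form_section M) (x : M) : Prop :=
  (forall u v : tangent x, g x u v = g x v u) /\
  (forall (a : R) (u v w : tangent x),
     g x u (a *: v + w) = a * g x u v + g x u w).

Definition fnorm (R : realType) (n : nat) (M : smoothManifold R n)
    (g : form_section M) (x : M) (u : tangent x) : R :=
  Num.sqrt (g x u u).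

(* The pullback of the Euclidean metric; only meaningful on [dom psi]. *)
Definition pullback_delta (R : realType) (n : nat) (M : smoothManifold R n)
    (psi : chart R n M) : form_section M :=
  fun x u v => \sum_i dchart psi u 0 i * dchart psi v 0 i.

Definition smooth_metric_on (R : realType) (n : nat) (M : smoothManifold R n)
    (W : set M) (h : form_section M) : Prop :=
  [/\ forall x, W x -> symmetric_bilinear h x,
      forall x, W x -> forall u : tangent x, u != 0 -> 0 < h x u u &
      forall phi : chart R n M, smooth_chart phi -> forall i j,
        smooth_on (cmap phi @` (dom phi `&` W))
                  (form_coef h phi i j : 'rV[R]_n -> R^o)].

(* {1 Rough metrics, Ell_loc and the action} *)

Definition Met (R : realType) (n : nat) (M : smoothManifold R n) :
    set (form_section M) :=
  [set g |
    [/\ forall x, symmetric_bilinear g x,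
        measurable_form g &
        forall x : M, exists (psi : chart R n M) (C : R),
          [/\ smooth_chart psi, dom psi x, 1 <= C &
              ae_on (dom psi) (fun y => forall u : tangent y,
                C^-1 * fnorm (pullback_delta psi) u <= fnorm g u
                  <= C * fnorm (pullback_delta psi) u)]]].

(* A smooth metric on K is one defined on an open neighbourhood [W] of K.
   Boundedness does not depend on it, so it is required for all of them. *)
Definition Linfty_loc (R : realType) (n : nat) (M : smoothManifold R n) :
    set (endo_section M) :=
  [set B | measurable_endo B /\
    forall K : set M, compact K ->
    forall (W : set M) (h : form_section M),
      open W -> K `<=` W -> smooth_metric_on W h ->
      exists C : R, ae_on K (fun x => forall u : tangent x,
        fnorm h (B x u) <= C * fnorm h u)].

Definition endo_one (R : realType) (n : nat) (M : smoothManifold R n) :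
  endo_section M := fun x => \1%VF.

Definition endo_comp (R : realType) (n : nat) (M : smoothManifold R n)
    (A B : endo_section M) : endo_section M :=
  fun x => (A x \o B x)%VF.

(* [(B x)^-1%VF] is the inverse of [B x] wherever [B x] is invertible. *)
Definition endo_inv (R : realType) (n : nat) (M : smoothManifold R n)
    (B : endo_section M) : endo_section M :=
  fun x => ((B x)^-1)%VF.

Definition Ell_loc (R : realType) (n : nat) (M : smoothManifold R n) :
    set (endo_section M) :=
  [set B | [/\ Linfty_loc B,
               ae (fun x : M => (B x \o endo_inv B x = \1)%VF /\
                                (endo_inv B x \o B x = \1)%VF) &
               Linfty_loc (endo_inv B)]].

(* g_B(x)[u, v] = g(x)[B(x)u, B(x)v] *)
Definition eta (R : realType) (n : nat) (M : smoothManifold R n)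
    (B : endo_section M) (g : form_section M) : form_section M :=
  fun x u v => g x (B x u) (B x v).

(* {1 Groups and actions on sets modulo an equivalence relation} *)

Record is_group_mod (T : Type) (G : set T) (eqG : T -> T -> Prop)
    (mul : T -> T -> T) (one : T) (inv : T -> T) : Prop := IsGroupMod {
  group_equiv : Equivalence eqG;
  group_one : G one;
  group_mul : forall a b, G a -> G b -> G (mul a b);
  group_inv : forall a, G a -> G (inv a);
  group_mul_congr : forall a a' b b', G a -> G a' -> G b -> G b' ->
    eqG a a' -> eqG b b' -> eqG (mul a b) (mul a' b');
  group_inv_congr : forall a a', G a -> G a' ->
    eqG a a' -> eqG (inv a) (inv a');
  group_mulA : forall a b c, G a -> G b -> G c ->
    eqG (mul a (mul b c)) (mul (mul a b) c);
  group_mul1 : forall a, G a -> eqG (mul one a) a /\ eqG (mul a one) a;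
  group_mulV : forall a, G a ->
    eqG (mul (inv a) a) one /\ eqG (mul a (inv a)) one
}.

(* A right action: g_(AB) = (g_A)_B, since g_B is a pullback of g. *)
Record is_group_action_mod (T S : Type) (G : set T) (eqG : T -> T -> Prop)
    (mul : T -> T -> T) (one : T) (inv : T -> T)
    (X : set S) (eqX : S -> S -> Prop) (act : T -> S -> S) : Prop :=
  IsGroupActionMod {
  action_group : is_group_mod G eqG mul one inv;
  action_equiv : Equivalence eqX;
  action_closed : forall a s, G a -> X s -> X (act a s);
  action_congr : forall a a' s s', G a -> G a' -> X s -> X s' ->
    eqG a a' -> eqX s s' -> eqX (act a s) (act a' s');
  action_one : forall s, X s -> eqX (act one s) s;
  action_mul : forall a b s, G a -> G b -> X s ->
    eqX (act (mul a b) s) (act b (act a s))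
}.

(* Main.v *)
Require Import Defs.
From HB Require Import structures.
From mathcomp Require Import all_boot all_order all_algebra.
From mathcomp Require Import all_classical all_reals all_analysis.
From mathcomp Require Import measurable_realfun ring lra.
Import Defs.
Set Implicit Arguments.
Unset Strict Implicit.
Unset Printing Implicit Defensive.
Import Order.TTheory GRing.Theory Num.Theory.
Import numFieldNormedType.Exports.
Local Open Scope classical_set_scope.
Local Open Scope ring_scope.

(** Parts (i) and (ii) are soft.  In a fixed chart the coefficients of
    [eta B g] and of [endo_comp A B] are polynomials in the coefficients of the
    factors, so measurability never requires a change of chart.  For the local
    norm bound of [eta B g], the pullback of the Euclidean metric by an atlas
    chart is a smooth metric ([pullback_delta_smooth]); [g] is comparable with
    it near every point ([Met_local_equiv]), and on a compact neighbourhood [B]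
    and its inverse are bounded for it ([Ell_loc_local_bound]).  The group
    axioms that involve inverses hold on the full-measure set where the factors
    are invertible.

    For part (iii), [g] and [h] are almost everywhere inner products.  Choose a
    measurable global frame of the tangent bundle ([measurable_frame]: the
    coordinate frames of countably many atlas charts, glued along a measurable
    partition) and orthonormalise it by the Gram-Schmidt process for [g] and
    for [h], obtaining frames [w] and [z].  The endomorphism
    [B u = \sum_i g(u, w_i) z_i] maps [w] to [z], hence [h (B u, B v) = g (u, v)]
    by Parseval, and exchanging the roles of [g] and [h] produces its inverse.
    It plays the part of the square root of the positive endomorphism
    representing [g] in terms of [h], and it is measurable because the
    Gram-Schmidt formulas involve only sums, products and a real power.
    Finally [B] is an isometry from
    [g] to [h], and both are locally comparable with any smooth metric, so [B]
    and its inverse are locally bounded ([isometry_Linfty_loc]).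

    The comparison of a smooth metric with a Euclidean one
    ([smooth_metric_local_equiv]) rests on the same orthonormal frames: at one
    point they bound the form below, and continuity of the coefficients
    propagates the bound to a neighbourhood. *)

(** * Lebesgue null sets and measurable functions *)

Lemma lebesgue_null_sub (R : realType) (n : nat) (A B : set 'rV[R]_n) :
  A `<=` B -> lebesgue_null B -> lebesgue_null A.
Proof.
move=> AB nB e e0; have [D [a [b [ab cov le_e]]]] := nB e e0.
by exists D, a, b; split=> //; exact: subset_trans cov.
Qed.

Lemma lebesgue_null0 (R : realType) (n : nat) : lebesgue_null (@set0 'rV[R]_n).
Proof.
move=> e e0; exists set0, (fun=> 0), (fun=> 0); split=> //.
by rewrite esum_set0 lee_fin ltW.
Qed.

(** Cover the k-th set with total volume at most [e / 2 ^ k.+1]; the families of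
    boxes are merged into one through a numbering of the pairs of integers. *)
Lemma lebesgue_null_bigcup (R : realType) (n : nat)
    (A : nat -> set 'rV[R]_n) :
  (forall k, lebesgue_null (A k)) -> lebesgue_null (\bigcup_k A k).
Proof.
move=> nA e e0.
have e2 k : 0 < e / (2 ^ k.+1)%:R by rewrite divr_gt0// ltr0n expn_gt0.
have /choice[Dab Dabn] : forall k, exists Dab : set nat *
    (nat -> 'rV[R]_n) * (nat -> 'rV[R]_n),
   [/\ forall j, Dab.1.1 j -> forall i, Dab.1.2 j 0 i <= Dab.2 j 0 i,
       A k `<=` \bigcup_(j in Dab.1.1) box (Dab.1.2 j) (Dab.2 j) &
       (\esum_(j in Dab.1.1) (\prod_i (Dab.2 j 0 i - Dab.1.2 j 0 i))%:E <=
          (e / (2 ^ k.+1)%:R)%:E)%E].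
  by move=> k; have [D [a [b H]]] := nA k _ (e2 k); exists (D, a, b).
pose D := [set: nat] `*`` (fun k => (Dab k).1.1).
pose dec m : nat * nat := odflt (0%N, 0%N) (unpickle m).
have decK x : dec (pickle x) = x by rewrite /dec pickleK.
exists (pickle @` D), (fun m => (Dab (dec m).1).1.2 (dec m).2),
  (fun m => (Dab (dec m).1).2 (dec m).2); split.
- move=> _ [[k j] [_ /= Dj] <-] i; rewrite decK /=.
  by have [+ _ _] := Dabn k; apply.
- move=> x [k _ Akx]; have [_ /(_ _ Akx)[j Dj bx] _] := Dabn k.
  by exists (pickle (k, j)); [exists (k, j)|rewrite decK].
- rewrite (@reindex_esum R (nat * nat)%type nat D (pickle @` D) pickle); last first.
    split; [by move=> x Dx; exists x| |exact: subset_refl].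
    by move=> x y _ _ xy; apply: (pcan_inj pickleK).
  under eq_esum do rewrite decK.
  rewrite /D -(@esum_esum R nat nat setT (fun k => (Dab k).1.1)
    (fun k j => (\prod_i ((Dab k).2 j 0 i - (Dab k).1.2 j 0 i))%:E)); last first.
    move=> k j _ Dj; have [H _ _] := Dabn k.
    by rewrite lee_fin; apply: prodr_ge0 => i _; rewrite subr_ge0; exact: H.
  apply: le_trans (epsilon_trick0 xpredT (ltW e0)).
  rewrite nneseries_esumT; last by move=> k; rewrite lee_fin ltW.
  by apply: le_esum => k _; have [] := Dabn k.
Qed.

Lemma lebesgue_nullU (R : realType) (n : nat) (A B : set 'rV[R]_n) :
  lebesgue_null A -> lebesgue_null B -> lebesgue_null (A `|` B).
Proof.
move=> nA nB.
have -> : A `|` B = \bigcup_k (if k is 0%N then A else B).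
  rewrite eqEsubset; split=> [x [Ax|Bx]|x [[|k] _ ?]]; last 2 first.
  - by left.
  - by right.
  - by exists 0%N.
  - by exists 1%N.
by apply: lebesgue_null_bigcup => -[].
Qed.

Lemma lebesgue_measurable_open (R : realType) (n : nat) (U : set 'rV[R]_n) :
  open U -> measurable (U : set (g_sigma_algebraType (@lebesgue_gen R n))).
Proof. by move=> oU; apply: sub_sigma_algebra; left. Qed.

Lemma lebesgue_measurable_null (R : realType) (n : nat) (N : set 'rV[R]_n) :
  lebesgue_null N -> measurable (N : set (g_sigma_algebraType (@lebesgue_gen R n))).
Proof. by move=> oU; apply: sub_sigma_algebra; right. Qed.

(** The sigma-algebra is complete: every subset of a null set is a generator. *)
Lemma lebesgue_measurable_fun_null (R : realType) (n : nat)
    (D N : set 'rV[R]_n) (f g : 'rV[R]_n -> R) :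
  lebesgue_null N -> (forall p, D p -> ~ N p -> f p = g p) ->
  lebesgue_measurable_fun D f -> lebesgue_measurable_fun D g.
Proof.
move=> nN fg mf mD Y mY.
have -> : D `&` g @^-1` Y =
    ((D `&` f @^-1` Y) `\` N) `|` (N `&` (D `&` g @^-1` Y)).
  rewrite eqEsubset; split=> [p [Dp gY]|p [[[Dp fY] Np]|[Np [Dp gY]]]] //=.
    have [Np|Np] := pselect (N p); first by right.
    by left; split=> //; split=> //=; rewrite fg.
  by split=> //=; rewrite -fg.
apply: measurableU.
  apply: measurableD; first exact: mf.
  exact: lebesgue_measurable_null.
by apply: lebesgue_measurable_null; apply: lebesgue_null_sub nN => p [].
Qed.

Lemma lebesgue_measurable_continuous (R : realType) (n : nat)
    (U : set 'rV[R]_n) (f : 'rV[R]_n -> R) :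
  open U -> (forall p, U p -> {for p, continuous f}) ->
  lebesgue_measurable_fun U f.
Proof.
move=> oU cf; apply: (measurability _ (RGenOpens.measurableE R)).
move=> _ [_ [a [b ->] <-]]; apply: lebesgue_measurable_open.
rewrite openE => p [Up fp]; apply: filterI; first exact: open_nbhs_nbhs.
by apply: cf => //; apply: open_nbhs_nbhs; split=> //; exact: interval_open.
Qed.

(** * Covering arguments *)

(** The Lindelof property.  Each basic open set contained in some [U z] is
    assigned one such [z]; the values form a countable family, which covers since
    every [x] has a basic neighbourhood contained in [U x]. *)
Lemma second_countable_subcover (T : topologicalType) (U : T -> set T) :
  @second_countable T -> (forall x, open (U x)) -> (forall x, U x x) ->
  T -> exists s : nat -> T, forall x, exists k, U (s k) x.
Proof.
move=> [B cB [oB bB]] oU Uxx x0.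
have /choice[c cP] : forall V : set T, exists y, forall z, V `<=` U z ->
    V `<=` U y.
  move=> V; have [[z Vz]|nz] := pselect (exists z, V `<=` U z).
    by exists z.
  by exists x0 => z Vz; exfalso; apply: nz; exists z.
have /countable_injP[f injf] := cB.
have /choice[s sP] : forall k, exists y, forall V, B V -> f V = k -> y = c V.
  move=> k; have [[V [BV fV]]|nV] := pselect (exists V, B V /\ f V = k).
    exists (c V) => W BW fW; congr c; apply: injf; rewrite ?inE//.
    by rewrite fV fW.
  by exists x0 => V BV fV; exfalso; apply: nV; exists V.
exists s => x; have [V [BV Vx] VU] := bB x _ (open_nbhs_nbhs (conj (oU x) (Uxx x))).
by exists (f V); rewrite (sP _ V BV erefl); exact: (cP V x).
Qed.

(** An induction principle for compact sets: with [P] the existence of an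
    essential bound, it patches local bounds into one. *)
Lemma compact_ideal (T : topologicalType) (K : set T) (P : set T -> Prop) :
  compact K -> P set0 -> (forall A B, A `<=` B -> P B -> P A) ->
  (forall A B, P A -> P B -> P (A `|` B)) ->
  (forall x, K x -> exists2 U, nbhs x U & P U) -> P K.
Proof.
move=> /compact_near_coveringP cK P0 Psub PU Ploc.
(* The near-covering property is used with the filter of all families that
   contain every set larger than some set satisfying [P]. *)
pose F : set_system (set T) := [set S | exists2 A, P A & forall B, A `<=` B -> S B].
have FF : Filter F.
  split; first by exists set0.
  - move=> S S' [A PA AS] [A' PA' AS']; exists (A `|` A'); first exact: PU.
    move=> B AB; split.
      by apply: AS => x Ax; apply: AB; left.
    by apply: AS' => x Ax; apply: AB; right.
  - by move=> S S' SS' [A PA AS]; exists A => // B /AS /SS'.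
have [|A PA KA] := cK (set T) F (fun A x => A x) FF.
  move=> x Kx; have [U xU PU'] := Ploc x Kx.
  exists (U, [set A | U `<=` A]); first by split=> //; exists U.
  by move=> [y A] [/= Uy]; exact.
by apply: Psub PA; exact: KA.
Qed.

(** * Stability of iterated differentiability *)

Lemma Ck_on_sub (R : realType) (V W : normedModType R) k (A B : set V)
    (f : V -> W) : A `<=` B -> Ck_on k B f -> Ck_on k A f.
Proof.
move=> AB; elim: k f => [|k IH] f /= => [cf x /AB|[df Df]]; first exact: cf.
by split=> [x /AB|v]; [exact: df|exact: IH].
Qed.

Lemma Ck_onW (R : realType) (V W : normedModType R) k (A : set V)
    (f : V -> W) : Ck_on k.+1 A f -> Ck_on k A f.
Proof.
elim: k f => [|k IH] f [df Df].
  by move=> x Ax; apply: differentiable_continuous; exact: df.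
by split=> // v; exact/IH/Df.
Qed.

Lemma near_eq_differentiable (R : realType) (V W : normedModType R)
    (f g : V -> W) (x : V) :
  {near x, f =1 g} -> differentiable f x -> differentiable g x.
Proof.
move=> fg df.
have fgx : f x = g x by exact: nbhs_singleton fg.
have [cdf ef] := (diff_locallyP x f).1 df.
have eg : g \o shift x = cst (g x) + 'd f x +o_ 0 id.
  apply/eqaddoP => e e0.
  have /eqaddoP/(_ e e0) := ef.
  have fg0 : \forall h \near (0 : V), f (h + x) = g (h + x).
    move: fg; rewrite (near_shift 0 x) subr0.
    by apply: filterS => h /=.
  apply: filterS2 fg0 => h /= fgh.
  by rewrite !fctE /= fgh fgx.
have dgf : 'd g x = 'd f x :> (V -> W) by exact: diff_unique eg.
by apply/diff_locallyP; rewrite dgf.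
Qed.

(** On an open set, equality passes to all directional derivatives.  The lemmas
    below use it to replace the derivative of a sum, product or coordinate by
    the formula for it, which is valid on [A] only. *)
Lemma Ck_on_ext (R : realType) (V W : normedModType R) k (A : set V)
    (f g : V -> W) :
  open A -> (forall x, A x -> f x = g x) -> Ck_on k A f -> Ck_on k A g.
Proof.
move=> oA; elim: k f g => [|k IH] f g fg.
  have near_fg x : A x -> {near x, f =1 g}.
    by move=> Ax; apply: filterS fg _; exact: open_nbhs_nbhs.
  move=> cf x Ax; rewrite /prop_for /continuous_at -(fg x Ax).
  by apply: cvg_trans (cf x Ax); apply: near_eq_cvg; exact: near_fg.
have near_fg x : A x -> {near x, f =1 g}.
  by move=> Ax; apply: filterS fg _; exact: open_nbhs_nbhs.
move=> [df Df]; split=> [x Ax|v].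
  by apply: near_eq_differentiable (df x Ax); exact: near_fg.
by apply: IH (Df v) => x Ax; apply: near_eq_derive; exact: near_fg.
Qed.

Lemma Ck_on_coord (R : realType) (V : normedModType R) n k (A : set V)
    (f : V -> 'rV[R]_n) j : open A ->
  Ck_on k A f -> Ck_on k A (fun x => f x 0 j : R^o).
Proof.
move=> oA; elim: k f => [|k IH] f /= => [cf x Ax|[df Df]].
  apply: (@continuous_comp _ _ _ f (fun v : 'rV[R]_n => v 0 j)).
    exact: cf.
  exact: coord_continuous.
split=> [x Ax|v].
  apply: (@differentiable_comp _ _ _ _ f (fun v : 'rV[R]_n => v 0 j : R^o)).
    exact: df.
  exact: differentiable_coord.
apply: Ck_on_ext (IH _ (Df v)) => // x Ax.
rewrite derive_mx; last exact/diff_derivable/df.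
by rewrite mxE.
Qed.

Lemma Ck_on_cst (R : realType) (V W : normedModType R) k (A : set V) (c : W) :
  Ck_on k A (fun=> c).
Proof.
elim: k c => [|k IH] c /=; first by move=> x _; exact: cst_continuous.
split=> [x _|v]; first exact: differentiable_cst.
by rewrite (_ : 'D_v _ = fun=> 0) //; apply/funext => x; rewrite derive_cst.
Qed.

Lemma Ck_onD (R : realType) (V W : normedModType R) k (A : set V)
    (f g : V -> W) : open A ->
  Ck_on k A f -> Ck_on k A g -> Ck_on k A (fun x => f x + g x).
Proof.
move=> oA; elim: k f g => [|k IH] f g /=.
  by move=> cf cg x Ax; apply: continuousD; [exact: cf|exact: cg].
move=> [df Df] [dg Dg]; split=> [x Ax|v].
  by apply: differentiableD; [exact: df|exact: dg].
apply: Ck_on_ext (IH _ _ (Df v) (Dg v)) => // x Ax.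
by rewrite (@deriveD _ _ _ f g)//; apply: diff_derivable; [exact: df|exact: dg].
Qed.

Lemma Ck_onM (R : realType) (V : normedModType R) k (A : set V)
    (f g : V -> R^o) : open A ->
  Ck_on k A f -> Ck_on k A g -> Ck_on k A (fun x => f x * g x : R^o).
Proof.
move=> oA; elim: k f g => [|k IH] f g.
  by move=> cf cg x Ax; apply: (@continuousM R V f g); [exact: cf|exact: cg].
move=> cf cg; have [df Df] := cf; have [dg Dg] := cg; split=> [x Ax|v].
  by apply: (@differentiableM _ _ f g); [exact: df|exact: dg].
have := Ck_onD oA (IH _ _ (Ck_onW cf) (Dg v)) (IH _ _ (Ck_onW cg) (Df v)).
apply: Ck_on_ext => // x Ax.
by rewrite (@deriveM _ _ f g)//; apply: diff_derivable; [exact: df|exact: dg].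
Qed.

Lemma Ck_on_sum (R : realType) (V W : normedModType R) k (A : set V)
    (I : Type) (r : seq I) (f : I -> V -> W) : open A ->
  (forall i, Ck_on k A (f i)) -> Ck_on k A (fun x => \sum_(i <- r) f i x).
Proof.
move=> oA cf; elim: r => [|i r IH].
  by under eq_fun do rewrite big_nil; exact: Ck_on_cst.
by under eq_fun do rewrite big_cons; exact: Ck_onD.
Qed.

(** * Calculus in charts *)

Section ChartCalculus.
Context {R : realType} {n : nat}.

Lemma chart_img_open (T : topologicalType) (phi : chart R n T) (U : set T) :
  open U -> open (cmap phi @` (dom phi `&` U)).
Proof.
move=> oU; rewrite openE => _ [x [dx Ux] <-].
have px : (cmap phi @` dom phi) (cmap phi x) by exists x.
have nU : nbhs (cmap phi x) (cinv phi @^-1` U).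
  by apply: cinv_continuous => //; rewrite cmapK//; exact: open_nbhs_nbhs.
have nI := open_nbhs_nbhs (conj (@img_open _ _ _ phi) px).
apply: filterS (filterI nI nU) => _ [[y dy <-] /=]; rewrite cmapK// => Uy.
by exists y.
Qed.

Lemma chart_img_nbhs (T : topologicalType) (phi : chart R n T) (U : set T) x :
  open U -> dom phi x -> U x -> nbhs (cmap phi x) (cmap phi @` (dom phi `&` U)).
Proof.
move=> oU px Ux; apply: open_nbhs_nbhs; split; first exact: chart_img_open.
by exists x.
Qed.

Lemma transition_differentiable (T : topologicalType) (phi psi : chart R n T) x :
  smooth_transition phi psi -> dom phi x -> dom psi x ->
  differentiable (cmap psi \o cinv phi) (cmap phi x).
Proof. by move=> /(_ 1)[+ _] px sx; apply; exists x. Qed.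

(** The chain rule for transition maps.  The right-hand side is a directional
    derivative because the two maps agree only near the point, which is what
    [near_eq_derive] transfers. *)
Lemma diff_transition_comp (T : topologicalType) (a b c : chart R n T) x w :
  dom a x -> dom b x -> dom c x ->
  differentiable (cmap b \o cinv a) (cmap a x) ->
  differentiable (cmap c \o cinv b) (cmap b x) ->
  'd (cmap c \o cinv b) (cmap b x) ('d (cmap b \o cinv a) (cmap a x) w) =
  'D_w (cmap c \o cinv a) (cmap a x).
Proof.
move=> ax bx cx dab dbc.
have bxE : (cmap b \o cinv a) (cmap a x) = cmap b x by rewrite /= cmapK.
have dbc' : differentiable (cmap c \o cinv b) ((cmap b \o cinv a) (cmap a x)).
  by rewrite bxE.
have dabc := differentiable_comp dab dbc'.
transitivity (('d (cmap c \o cinv b) ((cmap b \o cinv a) (cmap a x))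
  \o 'd (cmap b \o cinv a) (cmap a x)) w); first by rewrite bxE.
rewrite -diff_comp// -deriveE//; apply: near_eq_derive.
apply: filterS (chart_img_nbhs (@dom_open _ _ _ b) ax bx) => _ [y [ay yb] <-].
by rewrite /= !(cmapK ay) (cmapK yb).
Qed.

Lemma derive_transition_id (T : topologicalType) (a : chart R n T) x w :
  dom a x -> 'D_w (cmap a \o cinv a) (cmap a x) = w.
Proof.
move=> ax; rewrite (@near_eq_derive _ _ _ _ id) ?derive_id//.
apply: filterS (chart_img_nbhs openT ax I) => _ [y [ay _] <-].
by rewrite /= cmapK.
Qed.

Context {M : smoothManifold R n}.
Implicit Types (phi psi : chart R n M) (x : M).

Lemma atlas_smooth_chart phi : atlas phi -> smooth_chart phi.
Proof. by move=> aphi psi apsi; exact: atlas_compatible. Qed.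

Lemma chart_at_atlas x : atlas (chart_at x).
Proof. by rewrite /chart_at; case: cid => ? []. Qed.

Lemma chart_at_dom x : dom (chart_at x) x.
Proof. by rewrite /chart_at; case: cid => ? []. Qed.
#[local] Hint Resolve chart_at_dom chart_at_atlas : core.

(** Tangent vectors are stored in the coordinates of [chart_at x]; those
    coordinates cancel here, leaving the transition map from [phi] to [psi],
    whose derivatives are smooth as soon as one of the two charts belongs to the
    atlas. *)
Lemma dchart_dchart_inv phi psi x (w : 'rV[R]_n) :
  smooth_chart phi -> smooth_chart psi -> dom phi x -> dom psi x ->
  dchart psi (dchart_inv phi x w) =
  'D_w (cmap psi \o cinv phi) (cmap phi x).
Proof.
move=> sphi spsi px sx; apply: diff_transition_comp => //.
  by apply: transition_differentiable => //; have [] := sphi _ (chart_at_atlas x).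
by apply: transition_differentiable => //; have [] := spsi _ (chart_at_atlas x).
Qed.

Lemma dchart_invK phi x (w : 'rV[R]_n) : smooth_chart phi -> dom phi x ->
  dchart phi (dchart_inv phi x w) = w.
Proof.
by move=> sphi px; rewrite dchart_dchart_inv// derive_transition_id.
Qed.

Lemma dchartK phi x (u : tangent x) : smooth_chart phi -> dom phi x ->
  dchart_inv phi x (dchart phi u) = u.
Proof.
move=> sphi px; rewrite /dchart_inv /dchart diff_transition_comp//.
- exact: derive_transition_id.
- by apply: transition_differentiable => //; have [] := sphi _ (chart_at_atlas x).
- by apply: transition_differentiable => //; have [] := sphi _ (chart_at_atlas x).
Qed.

Lemma dchart_is_linear phi x : linear (@dchart R n M phi x).
Proof. by move=> k u v; rewrite /dchart; exact: linearP. Qed.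

Lemma dchart_inv_is_linear phi x : linear (@dchart_inv R n M phi x).
Proof. by move=> k u v; rewrite /dchart_inv; exact: linearP. Qed.

HB.instance Definition _ phi x :=
  GRing.isLinear.Build R (tangent x) 'rV[R]_n _ (@dchart R n M phi x)
    (@dchart_is_linear phi x).

HB.instance Definition _ phi x :=
  GRing.isLinear.Build R 'rV[R]_n (tangent x) _ (@dchart_inv R n M phi x)
    (@dchart_inv_is_linear phi x).

Lemma tangent_decomp phi x (u : tangent x) : smooth_chart phi -> dom phi x ->
  u = \sum_i dchart phi u 0 i *: coord_vector phi x i.
Proof.
move=> sphi px; rewrite -[LHS](dchartK u sphi px).
rewrite [X in dchart_inv _ _ X](row_sum_delta (dchart phi u)).
by rewrite linear_sum; apply: eq_bigr => i _; rewrite linearZ.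
Qed.

Lemma dchart_coord_vector phi x i j : smooth_chart phi -> dom phi x ->
  dchart phi (coord_vector phi x i) 0 j = (i == j)%:R.
Proof. by move=> sphi px; rewrite dchart_invK// mxE eqxx eq_sym. Qed.

Lemma dchart_eq0 phi x (u : tangent x) : smooth_chart phi -> dom phi x ->
  (dchart phi u == 0) = (u == 0).
Proof.
move=> sphi px; apply/eqP/eqP => [u0|->]; last exact: linear0.
by rewrite -(dchartK u sphi px) u0 linear0.
Qed.

Lemma form_sumr (g : form_section M) x (I : Type) (r : seq I) (c : I -> R)
    (u : tangent x) (v : I -> tangent x) : symmetric_bilinear g x ->
  g x u (\sum_(i <- r) c i *: v i) = \sum_(i <- r) c i * g x u (v i).
Proof.
move=> [_ lin]; have g0 : g x u 0 = 0.
  by have := lin 1 u 0 0; rewrite scaler0 addr0 mul1r => /eqP;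
    rewrite addrC -subr_eq subrr eq_sym => /eqP.
elim: r => [|i r IH]; first by rewrite !big_nil.
by rewrite !big_cons lin IH.
Qed.

Lemma form_suml (g : form_section M) x (I : Type) (r : seq I) (c : I -> R)
    (v : I -> tangent x) (u : tangent x) : symmetric_bilinear g x ->
  g x (\sum_(i <- r) c i *: v i) u = \sum_(i <- r) c i * g x (v i) u.
Proof.
move=> gx; have [sym _] := gx; rewrite sym form_sumr//.
by apply: eq_bigr => i _; rewrite sym.
Qed.

Lemma form_coefE (g : form_section M) phi x (u v : tangent x) :
  symmetric_bilinear g x -> smooth_chart phi -> dom phi x ->
  g x u v = \sum_i \sum_j dchart phi u 0 i * dchart phi v 0 j *
     g x (coord_vector phi x i) (coord_vector phi x j).
Proof.
move=> gx sphi px; rewrite {1}(tangent_decomp u sphi px) form_suml//.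
apply: eq_bigr => i _; rewrite {1}(tangent_decomp v sphi px) form_sumr//.
by rewrite mulr_sumr; apply: eq_bigr => j _; rewrite mulrA.
Qed.

Lemma pullback_delta_bilinear phi x : symmetric_bilinear (pullback_delta phi) x.
Proof.
split=> [u v|a u v w]; rewrite /pullback_delta.
  by apply: eq_bigr => i _; rewrite mulrC.
rewrite mulr_sumr -big_split; apply: eq_bigr => i _ /=.
by rewrite linearP !mxE; ring.
Qed.

Lemma pullback_delta_ge0 phi x (u : tangent x) : 0 <= pullback_delta phi u u.
Proof. by apply: sumr_ge0 => i _; rewrite -expr2 sqr_ge0. Qed.

Lemma pullback_delta_gt0 phi x (u : tangent x) : smooth_chart phi -> dom phi x ->
  u != 0 -> 0 < pullback_delta phi u u.
Proof.
move=> sphi px; rewrite lt_def pullback_delta_ge0 andbT; apply: contra.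
rewrite /pullback_delta psumr_eq0; last by move=> i _; rewrite -expr2 sqr_ge0.
move=> /allP u0; rewrite -(dchart_eq0 _ sphi px); apply/eqP/rowP => i.
by rewrite mxE; have := u0 i (mem_index_enum i); rewrite mulf_eq0 orbb => /eqP.
Qed.

(** The coefficients of the pulled back Euclidean metric in a chart [phi] are
    sums of products of the partial derivatives of the transition map from [phi]
    to [a].  For [a] in the atlas this map is smooth by definition of a smooth
    chart. *)
Lemma pullback_delta_smooth a : atlas a ->
  smooth_metric_on (dom a) (@pullback_delta R n M a).
Proof.
move=> aa; have sa := atlas_smooth_chart aa; split.
- by move=> x _; exact: pullback_delta_bilinear.
- by move=> x ax u; exact: pullback_delta_gt0.
move=> phi sphi i j k.
have oA := chart_img_open (phi := phi) (@dom_open _ _ _ a).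
have cF l m : Ck_on k (cmap phi @` (dom phi `&` dom a)) (fun p =>
    ('D_(delta_mx 0 l) (cmap a \o cinv phi) p) 0 m : R^o).
  apply: Ck_on_coord => //.
  by have [sphia _] := sphi _ aa; have [_ ] := sphia k.+1; apply.
apply: Ck_on_ext (Ck_on_sum _ oA (fun m => Ck_onM oA (cF i m) (cF j m))) => //.
move=> _ [x [px ax] <-]; rewrite /form_coef /pullback_delta cmapK//.
by apply: eq_bigr => m _; rewrite !dchart_dchart_inv.
Qed.

End ChartCalculus.

(** * Almost everywhere properties *)

Section AlmostEverywhere.
Context {R : realType} {n : nat} {M : smoothManifold R n}.

Lemma null_set_sub (A B : set M) : A `<=` B -> null_set B -> null_set A.
Proof.
move=> AB nB phi sphi; apply: lebesgue_null_sub (nB phi sphi).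
by apply: image_subset; exact: setSI.
Qed.

Lemma null_set0 : null_set (@set0 M).
Proof. by move=> phi _; rewrite set0I image_set0; exact: lebesgue_null0. Qed.

Lemma null_setU (A B : set M) : null_set A -> null_set B -> null_set (A `|` B).
Proof.
move=> nA nB phi sphi; rewrite setIUl image_setU.
by apply: lebesgue_nullU; [exact: nA|exact: nB].
Qed.

Lemma null_set_bigcup (A : nat -> set M) :
  (forall k, null_set (A k)) -> null_set (\bigcup_k A k).
Proof.
move=> nA phi sphi; rewrite setI_bigcupl image_bigcup.
by apply: lebesgue_null_bigcup => k; exact: nA.
Qed.

Lemma ae_onT (A : set M) (P : M -> Prop) : (forall x, A x -> P x) -> ae_on A P.
Proof.
move=> AP; apply: null_set_sub null_set0 => x [Ax nPx].
by apply: nPx; exact: AP.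
Qed.

Lemma ae_on_sub (A B : set M) (P : M -> Prop) :
  A `<=` B -> ae_on B P -> ae_on A P.
Proof. by move=> AB; apply: null_set_sub => x [/AB]. Qed.

Lemma ae_on_impl (A : set M) (P Q : M -> Prop) :
  (forall x, A x -> P x -> Q x) -> ae_on A P -> ae_on A Q.
Proof.
by move=> PQ; apply: null_set_sub => x [Ax nQ]; split=> // Px; exact/nQ/PQ.
Qed.

Lemma ae_on_and (A : set M) (P Q : M -> Prop) :
  ae_on A P -> ae_on A Q -> ae_on A (fun x => P x /\ Q x).
Proof.
move=> aP aQ; apply: null_set_sub (null_setU aP aQ) => x [Ax nPQ].
have [Px|nP] := pselect (P x); last by left.
by right; split=> // Qx; exact: nPQ.
Qed.

Lemma ae_on_and3 (A : set M) (P Q S : M -> Prop) :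
  ae_on A P -> ae_on A Q -> ae_on A S -> ae_on A (fun x => [/\ P x, Q x & S x]).
Proof.
move=> aP aQ aS; apply: ae_on_impl (ae_on_and aP (ae_on_and aQ aS)).
by move=> x _ [? []].
Qed.

Lemma ae_on_setU (A B : set M) (P : M -> Prop) :
  ae_on A P -> ae_on B P -> ae_on (A `|` B) P.
Proof.
move=> aA aB; apply: null_set_sub (null_setU aA aB) => x [[Ax|Bx] nP].
  by left.
by right.
Qed.

Lemma ae_ae_on (A : set M) (P : M -> Prop) : ae P -> ae_on A P.
Proof. exact: ae_on_sub. Qed.

(** Null sets are only stable under countable unions; second countability
    reduces an arbitrary open cover to that case. *)
Lemma ae_local (P : M -> Prop) :
  (forall x, exists U : set M, [/\ open U, U x & ae_on U P]) -> ae P.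
Proof.
move=> /choice[U HU].
have oU x : open (U x) by have [] := HU x.
have Ux x : U x x by have [] := HU x.
have aU x : ae_on (U x) P by have [] := HU x.
have [[x0 _]|M0] := pselect (exists x : M, True); last first.
  by apply: ae_onT => x _; exfalso; apply: M0; exists x.
have [s sU] := second_countable_subcover (carrier_second_countable M) oU Ux x0.
apply: null_set_sub (null_set_bigcup (fun k => aU (s k))) => x [_ nP].
by have [k Uk] := sU x; exists k.
Qed.

End AlmostEverywhere.

(** * Measurability in a chart *)

Section MeasurableFields.
Context {R : realType} {n : nat} {M : smoothManifold R n}.
Implicit Types (phi : chart R n M) (B : endo_section M) (g : form_section M).

Lemma lebesgue_measurableD (D : set 'rV[R]_n) (f g : 'rV[R]_n -> R) :
  lebesgue_measurable_fun D f -> lebesgue_measurable_fun D g ->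
  lebesgue_measurable_fun D (fun p => f p + g p).
Proof.
exact: (@measurable_funD _ (g_sigma_algebraType (@lebesgue_gen R n))).
Qed.

Lemma lebesgue_measurableM (D : set 'rV[R]_n) (f g : 'rV[R]_n -> R) :
  lebesgue_measurable_fun D f -> lebesgue_measurable_fun D g ->
  lebesgue_measurable_fun D (fun p => f p * g p).
Proof.
exact: (@measurable_funM _ (g_sigma_algebraType (@lebesgue_gen R n))).
Qed.

Lemma lebesgue_measurable_sum (D : set 'rV[R]_n) (I : Type) (r : seq I)
    (f : I -> 'rV[R]_n -> R) : (forall i, lebesgue_measurable_fun D (f i)) ->
  lebesgue_measurable_fun D (fun p => \sum_(i <- r) f i p).
Proof.
move=> mf; elim: r => [|i r IH].
  by under eq_fun do rewrite big_nil; exact: measurable_cst.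
by under eq_fun do rewrite big_cons; exact: lebesgue_measurableD.
Qed.

Lemma lebesgue_measurable_ext (D : set 'rV[R]_n) (f g : 'rV[R]_n -> R) :
  (forall p, D p -> f p = g p) ->
  lebesgue_measurable_fun D f -> lebesgue_measurable_fun D g.
Proof. by move=> fg; apply: eq_measurable_fun => p /[!inE]; exact: fg. Qed.

Definition measurable_scalar_in phi (f : M -> R) :=
  lebesgue_measurable_fun (cmap phi @` dom phi) (f \o cinv phi).

(** Coordinates are taken in the same chart in which the point is read, so
    that coordinate fields have constant coefficients and measurability is
    preserved by the algebraic operations one chart at a time. *)
Definition measurable_field_in phi (X : forall x : M, tangent x) :=
  forall j, measurable_scalar_in phi (fun x => dchart phi (X x) 0 j).

Lemma measurable_scalar_ext phi (f g : M -> R) :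
  (forall x, dom phi x -> f x = g x) ->
  measurable_scalar_in phi f -> measurable_scalar_in phi g.
Proof.
move=> fg; apply: lebesgue_measurable_ext => _ [x px <-] /=.
by rewrite cmapK// fg.
Qed.

Lemma coord_vector_measurable phi i : smooth_chart phi ->
  measurable_field_in phi (coord_vector phi ^~ i).
Proof.
move=> sphi j; apply: measurable_scalar_ext (_ : measurable_scalar_in phi
  (fun=> (i == j)%:R)) => [x px|]; last exact: measurable_cst.
by rewrite dchart_coord_vector.
Qed.

Lemma endo_apply_measurable B phi X : smooth_chart phi -> measurable_endo B ->
  measurable_field_in phi X -> measurable_field_in phi (fun x => B x (X x)).
Proof.
move=> sphi mB mX j.
apply: measurable_scalar_ext (_ : measurable_scalar_in phi (fun x => \sum_i
  dchart phi (X x) 0 i * dchart phi (B x (coord_vector phi x i)) 0 j)).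
  move=> x px; rewrite [in RHS](tangent_decomp (X x) sphi px) !linear_sum.
  by rewrite summxE; apply: eq_bigr => i _; rewrite !linearZ mxE.
apply: lebesgue_measurable_sum => i; apply: lebesgue_measurableM; first exact: mX.
exact: mB.
Qed.

Lemma form_apply_measurable g phi X Y : smooth_chart phi ->
  (forall x, symmetric_bilinear g x) -> measurable_form g ->
  measurable_field_in phi X -> measurable_field_in phi Y ->
  measurable_scalar_in phi (fun x => g x (X x) (Y x)).
Proof.
move=> sphi bg mg mX mY.
apply: measurable_scalar_ext (fun x px => esym (form_coefE (X x) (Y x) (bg x)
  sphi px)) _.
apply: lebesgue_measurable_sum => i; apply: lebesgue_measurable_sum => j.
apply: lebesgue_measurableM; last exact: mg.
by apply: lebesgue_measurableM; [exact: mX|exact: mY].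
Qed.

Lemma measurable_endo_comp A B : measurable_endo A -> measurable_endo B ->
  measurable_endo (endo_comp A B).
Proof.
move=> mA mB phi sphi i j.
have mABi := endo_apply_measurable sphi mA
  (endo_apply_measurable sphi mB (coord_vector_measurable i sphi)).
change (measurable_scalar_in phi
  (fun x => dchart phi (endo_comp A B x (coord_vector phi x i)) 0 j)).
apply: measurable_scalar_ext (mABi j) => x px.
by rewrite /endo_comp lfunE.
Qed.

Lemma measurable_endo_one : measurable_endo (@endo_one R n M).
Proof.
move=> phi sphi i j.
change (measurable_scalar_in phi
  (fun x => dchart phi (endo_one x (coord_vector phi x i)) 0 j)).
apply: measurable_scalar_ext
  (coord_vector_measurable i sphi j) => x px.
by rewrite /endo_one lfunE.
Qed.

Lemma measurable_eta B g : (forall x, symmetric_bilinear g x) ->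
  measurable_endo B -> measurable_form g -> measurable_form (eta B g).
Proof.
move=> bg mB mg phi sphi i j.
change (measurable_scalar_in phi (fun x =>
  g x (B x (coord_vector phi x i)) (B x (coord_vector phi x j)))).
by apply: form_apply_measurable => //; apply: endo_apply_measurable => //;
  exact: coord_vector_measurable.
Qed.

Lemma measurable_endo_ae A B : endo_ae_eq A B ->
  measurable_endo A -> measurable_endo B.
Proof.
move=> AB mA phi sphi i j.
apply: lebesgue_measurable_fun_null (AB phi sphi) _ (mA phi sphi i j).
move=> _ [x px <-] nAB; rewrite /endo_coef cmapK//.
have [->//|nABx] := pselect (A x = B x).
by exfalso; apply: nAB; exists x.
Qed.

End MeasurableFields.

(** * The group of locally elliptic endomorphisms *)

Section EllipticGroup.
Context {R : realType} {n : nat} {M : smoothManifold R n}.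
Implicit Types (A B : endo_section M) (g h : form_section M).

Lemma endo_ae_equiv : RelationClasses.Equivalence (@endo_ae_eq R n M).
Proof.
split.
- by move=> A; exact: ae_onT.
- by move=> A B; apply: ae_on_impl.
- move=> A B C AB BC; apply: ae_on_impl (ae_on_and AB BC).
  by move=> x _ [-> ->].
Qed.

Lemma form_ae_equiv : RelationClasses.Equivalence (@form_ae_eq R n M).
Proof.
split.
- by move=> g; exact: ae_onT.
- by move=> g h; apply: ae_on_impl => x _ gh u v.
- move=> g h k gh hk; apply: ae_on_impl (ae_on_and gh hk).
  by move=> x _ [gx hx] u v; rewrite gx.
Qed.

Lemma Linfty_loc_ae A B : endo_ae_eq A B -> Linfty_loc A -> Linfty_loc B.
Proof.
move=> AB [mA bA]; split; first exact: measurable_endo_ae mA.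
move=> K cK W h oW KW hW; have [C aC] := bA K cK W h oW KW hW.
exists C; apply: ae_on_impl (ae_on_and (ae_ae_on K AB) aC).
by move=> x _ [-> +] u; exact.
Qed.

Lemma Linfty_loc_comp A B : Linfty_loc A -> Linfty_loc B ->
  Linfty_loc (endo_comp A B).
Proof.
move=> [mA bA] [mB bB]; split; first exact: measurable_endo_comp.
move=> K cK W h oW KW hW.
have [C aC] := bA K cK W h oW KW hW.
have [D aD] := bB K cK W h oW KW hW.
(* The bound [C] may be negative, for instance when [K] is a null set. *)
exists (`|C| * D); apply: ae_on_impl (ae_on_and aC aD).
move=> x _ [Cx Dx] u; rewrite /endo_comp lfunE /=.
apply: le_trans (Cx (B x u)) _; rewrite -mulrA.
apply: le_trans (_ : `|C| * fnorm h (B x u) <= _).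
  by apply: ler_wpM2r; [exact: sqrtr_ge0|exact: ler_norm].
by apply: ler_wpM2l.
Qed.

Lemma Linfty_loc_one : Linfty_loc (@endo_one R n M).
Proof.
split; first exact: measurable_endo_one.
move=> K cK W h oW KW hW; exists 1; apply: ae_onT => x _ u.
by rewrite /endo_one lfunE mul1r.
Qed.

Definition ae_invertible B := ae (fun x : M =>
  (B x \o endo_inv B x = \1)%VF /\ (endo_inv B x \o B x = \1)%VF).

(** [f^-1] is only a section of [f] on its image; injectivity of [f], which
    follows from the left inverse, makes it the two-sided inverse. *)
Lemma lfun_inv_unique (V : vectType R) (f g : 'End(V)) :
  (f \o g = \1)%VF -> (g \o f = \1)%VF -> (f^-1)%VF = g.
Proof.
move=> fg gf; have injf : lker f == 0%VS.
  apply/lker0P => u v fuv; rewrite -[u]id_lfunE -[v]id_lfunE -gf.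
  by rewrite !comp_lfunE fuv.
apply/lfunP => u; apply: (lker0P injf).
have -> : f (f^-1%VF u) = u.
  apply: limg_lfunVK; have -> : u = f (g u) by rewrite -comp_lfunE fg id_lfunE.
  exact/memv_img/memvf.
by rewrite -comp_lfunE fg id_lfunE.
Qed.

Lemma endo_inv_ae A B : ae (fun x : M =>
    (A x \o B x = \1)%VF /\ (B x \o A x = \1)%VF) ->
  endo_ae_eq (endo_inv A) B.
Proof. by apply: ae_on_impl => x _ [AB BA]; exact: lfun_inv_unique. Qed.

Lemma ae_invertible_of_inverse A B : ae (fun x : M =>
    (A x \o B x = \1)%VF /\ (B x \o A x = \1)%VF) -> ae_invertible A.
Proof.
move=> AB; apply: ae_on_impl (ae_on_and (endo_inv_ae AB) AB).
by move=> x _ [-> ].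
Qed.

(** Membership is obtained below by exhibiting an inverse, rather than by
    handling the canonical one, which is arbitrary where [A] is not
    invertible. *)
Lemma Ell_loc_inverse A B : Linfty_loc A -> Linfty_loc B ->
  ae (fun x : M => (A x \o B x = \1)%VF /\ (B x \o A x = \1)%VF) -> Ell_loc A.
Proof.
move=> lA lB AB; split=> //; first exact: ae_invertible_of_inverse AB.
apply: Linfty_loc_ae lB; have [_ sym _] := endo_ae_equiv; apply: sym.
exact: endo_inv_ae.
Qed.

Lemma Ell_loc_one : Ell_loc (@endo_one R n M).
Proof.
apply: (Ell_loc_inverse Linfty_loc_one Linfty_loc_one).
by apply: ae_onT => x _; rewrite comp_lfun1l.
Qed.

Lemma Ell_loc_inv B : Ell_loc B -> Ell_loc (endo_inv B).
Proof.
move=> [lB aB lBi]; apply: (Ell_loc_inverse lBi lB).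
by apply: ae_on_impl aB => x _ [].
Qed.

Lemma comp_inverse A B : ae_invertible A -> ae_invertible B ->
  ae (fun x : M =>
   (endo_comp A B x \o endo_comp (endo_inv B) (endo_inv A) x = \1)%VF /\
   (endo_comp (endo_inv B) (endo_inv A) x \o endo_comp A B x = \1)%VF).
Proof.
move=> iA iB; apply: ae_on_impl (ae_on_and iA iB) => x _ [[A1 A2] [B1 B2]].
rewrite /endo_comp; split.
  by rewrite comp_lfunA -[X in (X \o _)%VF]comp_lfunA B1 comp_lfun1r A1.
by rewrite comp_lfunA -[X in (X \o _)%VF]comp_lfunA A2 comp_lfun1r B2.
Qed.

Lemma Ell_loc_comp A B : Ell_loc A -> Ell_loc B -> Ell_loc (endo_comp A B).
Proof.
move=> [lA aA lAi] [lB aB lBi].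
by apply: (Ell_loc_inverse (Linfty_loc_comp lA lB) (Linfty_loc_comp lBi lAi));
  exact: comp_inverse.
Qed.

Lemma Ell_loc_group : is_group_mod (@Ell_loc R n M) (@endo_ae_eq R n M)
  (@endo_comp R n M) (@endo_one R n M) (@endo_inv R n M).
Proof.
split.
- exact: endo_ae_equiv.
- exact: Ell_loc_one.
- exact: Ell_loc_comp.
- exact: Ell_loc_inv.
- move=> A A' B B' _ _ _ _ AA BB; apply: ae_on_impl (ae_on_and AA BB).
  by move=> x _ [Ax Bx]; rewrite /endo_comp Ax Bx.
- by move=> A A' _ _; apply: ae_on_impl => x _ Ax; rewrite /endo_inv Ax.
- by move=> A B C _ _ _; apply: ae_onT => x _; rewrite /endo_comp comp_lfunA.
- move=> A _; split; apply: ae_onT => x _; rewrite /endo_comp.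
    by rewrite comp_lfun1l.
  by rewrite comp_lfun1r.
- move=> A [_ iA _]; split; apply: ae_on_impl iA => x _ [A1 A2] //.
Qed.

End EllipticGroup.

(** * Gram-Schmidt orthonormalisation *)

Section GramSchmidt.
Context {R : realType} {n : nat} {M : smoothManifold R n}.
Implicit Types (phi psi : chart R n M) (x : M) (g : form_section M).

Definition pos_def g x := forall u : tangent x, u != 0 -> 0 < g x u u.

(** [gram_schmidt b e k i] is meaningful for [i < k].  All operations are total:
    where the form is not positive definite the result is arbitrary but still a
    measurable function of the point. *)
Fixpoint gram_schmidt (V : lmodType R) (b : V -> V -> R) (e : nat -> V)
    (k : nat) : nat -> V :=
  if k is k'.+1 then
    let w := gram_schmidt b e k' in
    let s := e k' - \sum_(j < k') b (e k') (w j) *: w j in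
    fun i => if i == k' then (b s s) `^ (- 2^-1) *: s else w i
  else fun=> 0.

(** The coordinate frame of [phi], extended by zero beyond the dimension so as
    to be indexed by all integers, as the recursion requires. *)
Definition frame_vector phi x (i : nat) : tangent x :=
  dchart_inv phi x (\row_j (i == j)%:R).

Lemma dchart_frame_vector phi x i j : smooth_chart phi -> dom phi x ->
  dchart phi (frame_vector phi x i) 0 j = (i == j)%:R.
Proof. by move=> sphi px; rewrite dchart_invK// mxE. Qed.

Lemma formD g x (u v w : tangent x) : symmetric_bilinear g x ->
  g x u (v + w) = g x u v + g x u w.
Proof. by move=> [_ lin]; have := lin 1 u v w; rewrite scale1r mul1r. Qed.

Lemma formZ g x a (u v : tangent x) : symmetric_bilinear g x ->
  g x u (a *: v) = a * g x u v.
Proof.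
move=> bg; have := form_sumr [:: tt] (fun=> a) u (fun=> v) bg.
by rewrite !big_seq1.
Qed.

Lemma formB g x (u v w : tangent x) : symmetric_bilinear g x ->
  g x u (v - w) = g x u v - g x u w.
Proof. by move=> bg; rewrite formD// -scaleN1r formZ// mulN1r. Qed.

Lemma powR_normalize (t : R) : 0 < t -> t `^ (- 2^-1) * (t `^ (- 2^-1) * t) = 1.
Proof.
move=> t0; have tn0 a : a ==> (t != 0) by rewrite (gt_eqF t0) implybT.
rewrite mulrA -powRD// -opprD.
have -> : 2^-1 + 2^-1 = 1 :> R by field.
by rewrite powRN powRr1 ?ltW// mulVf// gt_eqF.
Qed.

(** The second assertion says that the first [k] vectors lie in the span of the
    first [k] coordinate vectors.  It is what keeps the recursion going: the
    [k]-th coordinate of the new vector before normalisation is [1], so this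
    vector is nonzero and has positive length. *)
Lemma gram_schmidt_orthonormal g phi x k :
  symmetric_bilinear g x -> pos_def g x -> smooth_chart phi -> dom phi x ->
  (k <= n)%N ->
  (forall i j, (i < k)%N -> (j < k)%N ->
    g x (gram_schmidt (g x) (frame_vector phi x) k i)
        (gram_schmidt (g x) (frame_vector phi x) k j) = (i == j)%:R) /\
  (forall i (m : 'I_n), (i < k)%N -> (k <= m)%N ->
    dchart phi (gram_schmidt (g x) (frame_vector phi x) k i) 0 m = 0).
Proof.
move=> bg pg sphi px; elim: k => [|k IH] kn; first by split.
have {IH}[on lt0] := IH (ltnW kn); rewrite /=.
set w := gram_schmidt _ _ k in on lt0 *.
set s := frame_vector phi x k - _.
have sE (m : 'I_n) : (k <= m)%N -> dchart phi s 0 m = (k == m)%:R.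
  move=> km; rewrite /s linearB linear_sum mxE dchart_frame_vector//.
  rewrite mxE summxE big1 ?subr0// => j _.
  by rewrite linearZ mxE lt0// mulr0.
have s0 : s != 0.
  apply/eqP => s0; have := sE (Ordinal kn) (leqnn k).
  by rewrite s0 linear0 mxE eqxx => /esym/eqP; rewrite oner_eq0.
have ws i : (i < k)%N -> g x (w i) s = 0.
  move=> ik; rewrite formB// form_sumr// (bigD1 (Ordinal ik))//= big1 => [|j jk].
    by rewrite on// eqxx mulr1 addr0 bg.1 subrr.
  rewrite on//; case: eqP => [ij|]; last by rewrite mulr0.
  by exfalso; move/eqP: jk; apply; apply: val_inj.
split=> [i j|i m].
  rewrite !ltnS (leq_eqVlt i) (leq_eqVlt j) => /orP[/eqP->|ik] /orP[/eqP->|jk].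
  - by rewrite !eqxx formZ// bg.1 formZ// powR_normalize// pg.
  - by rewrite eqxx (ltn_eqF jk) (gtn_eqF jk) bg.1 formZ// ws// mulr0.
  - by rewrite eqxx (ltn_eqF ik) formZ// ws// mulr0.
  - by rewrite (ltn_eqF ik) (ltn_eqF jk) on.
rewrite ltnS (leq_eqVlt i) => /orP[/eqP->|ik] km.
  by rewrite eqxx linearZ mxE sE 1?ltnW// (ltn_eqF km) mulr0.
by rewrite (ltn_eqF ik) lt0// ltnW.
Qed.

(** With [W] the matrix of coordinates of the [w i] and [G] the Gram matrix of
    the coordinate frame, orthonormality reads [W G W^T = 1].  A one-sided
    inverse of a square matrix is two-sided, so [G W^T W = 1], and this is the
    expansion. *)
Lemma orthonormal_expansion g phi x (w : 'I_n -> tangent x) (u : tangent x) :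
  symmetric_bilinear g x -> smooth_chart phi -> dom phi x ->
  (forall i j, g x (w i) (w j) = (i == j)%:R) ->
  u = \sum_i g x u (w i) *: w i.
Proof.
move=> bg sphi px ow.
pose W : 'M[R]_n := \matrix_(i, j) dchart phi (w i) 0 j.
pose G : 'M[R]_n := \matrix_(i, j) g x (coord_vector phi x i) (coord_vector phi x j).
have GW (v : tangent x) i : (dchart phi v *m (G *m W^T)) 0 i = g x v (w i).
  rewrite (form_coefE v (w i) bg sphi px) mulmxA mxE exchange_big /=.
  apply: eq_bigr => j _; rewrite !mxE mulr_suml.
  by apply: eq_bigr => l _; rewrite !mxE; ring.
have WGW : W *m (G *m W^T) = 1%:M.
  apply/matrixP => i j; rewrite [RHS]mxE -ow -GW [LHS]mxE [RHS]mxE.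
  by apply: eq_bigr => l _; rewrite mxE.
have GWW := mulmx1C WGW.
rewrite -[LHS](dchartK u sphi px) -[RHS](dchartK _ sphi px); congr dchart_inv.
rewrite -[LHS]mulmx1 -GWW mulmxA; apply/rowP => j.
rewrite linear_sum mxE summxE; apply: eq_bigr => i _.
by rewrite GW linearZ !mxE.
Qed.

Lemma orthonormal_parseval g x (w : 'I_n -> tangent x) (u v : tangent x) :
  symmetric_bilinear g x -> u = \sum_i g x u (w i) *: w i ->
  g x u v = \sum_i g x u (w i) * g x v (w i).
Proof.
move=> bg uE; rewrite {1}uE form_suml//; apply: eq_bigr => i _.
by rewrite [g x v _]bg.1.
Qed.

End GramSchmidt.

(** * Local comparison of smooth metrics with Euclidean ones *)

Section LocalComparison.
Context {R : realType} {n : nat} {M : smoothManifold R n}.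
Implicit Types (phi psi : chart R n M) (x : M) (g h m : form_section M).

(** From [`|v i * v j| <= (v i ^+ 2 + v j ^+ 2) / 2]. *)
Lemma quadratic_bound (a : 'I_n -> 'I_n -> R) (v : 'I_n -> R) (K : R) :
  (forall i j, `|a i j| <= K) ->
  `|\sum_i \sum_j v i * v j * a i j| <= K * n%:R * \sum_i v i * v i.
Proof.
move=> aK.
apply: le_trans (_ : \sum_i \sum_j K * ((v i * v i + v j * v j) / 2) <= _).
  apply: le_trans (ler_norm_sum _ _ _) _; apply: ler_sum => i _.
  apply: le_trans (ler_norm_sum _ _ _) _; apply: ler_sum => j _.
  rewrite normrM mulrC; apply: ler_pM => //.
  have := sqr_ge0 (v i - v j); have := sqr_ge0 (v i + v j).
  by rewrite ler_norml !expr2 => ? ?; apply/andP; split; nra.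
under eq_bigr do rewrite -mulr_sumr -mulr_suml big_split /= sumr_const card_ord.
rewrite -mulr_sumr -mulr_suml big_split /= sumr_const card_ord sumrMnl.
by rewrite -[X in X + _]mulr_natr -[X in _ + X]mulr_natr; rewrite le_eqVlt; apply/orP; left; apply/eqP; field.
Qed.

(** In the expansion of [u] in an orthonormal frame every coefficient is at most
    [Num.sqrt (g x u u)] by Parseval, so the coordinates of [u] are bounded by this
    number times the coordinates of the frame. *)
Lemma pos_def_lower_bound g phi x :
  symmetric_bilinear g x -> pos_def g x -> smooth_chart phi -> dom phi x ->
  exists2 c : R, 0 < c & forall u : tangent x,
    c * pullback_delta phi u u <= g x u u.
Proof.
move=> bg pg sphi px.
have [on _] := gram_schmidt_orthonormal bg pg sphi px (leqnn n).
pose w (i : 'I_n) := gram_schmidt (g x) (frame_vector phi x) n i.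
have ow i j : g x (w i) (w j) = (i == j)%:R by rewrite on.
(* [Num.sqrt T] bounds the coordinates of the frame; the [1] added to it makes the
   constant positive in dimension zero. *)
pose T := \sum_j (\sum_i `|dchart phi (w i) 0 j|) ^+ 2.
have T0 : 0 <= T by apply: sumr_ge0 => j _; exact: sqr_ge0.
exists (T + 1)^-1; first by rewrite invr_gt0; lra.
move=> u; rewrite ler_pdivrMl; last lra.
have uE := orthonormal_expansion u bg sphi px ow.
have guu := orthonormal_parseval u bg uE.
have gu0 : 0 <= g x u u.
  by rewrite guu; apply: sumr_ge0 => i _; rewrite -expr2 sqr_ge0.
have ci i : `|g x u (w i)| <= Num.sqrt (g x u u).
  rewrite -sqrtr_sqr ler_sqrt// guu (bigD1 i)//= expr2 lerDl.
  by apply: sumr_ge0 => j _; rewrite -expr2 sqr_ge0.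
suff: pullback_delta phi u u <= T * g x u u by nra.
rewrite /pullback_delta mulr_suml; apply: ler_sum => j _.
rewrite -expr2 -[g x u u in leRHS]sqr_sqrtr// -exprMn -[leLHS]ger0_norm ?sqr_ge0//.
rewrite normrX; apply: lerXn2r; rewrite ?nnegrE//.
  by rewrite mulr_ge0 ?sqrtr_ge0// sumr_ge0.
rewrite {1}uE linear_sum summxE mulr_suml.
apply: le_trans (ler_norm_sum _ _ _) _; apply: ler_sum => i _.
by rewrite linearZ mxE normrM mulrC ler_wpM2l.
Qed.

Lemma pos_def_coef_lower_bound g phi x :
  symmetric_bilinear g x -> pos_def g x -> smooth_chart phi -> dom phi x ->
  exists2 c : R, 0 < c & forall v : 'I_n -> R,
    c * \sum_i v i * v i <= \sum_i \sum_j v i * v j *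
      g x (coord_vector phi x i) (coord_vector phi x j).
Proof.
move=> bg pg sphi px; have [c c0 lb] := pos_def_lower_bound bg pg sphi px.
exists c => // v; have := lb (dchart_inv phi x (\row_i v i)).
rewrite (form_coefE _ _ bg sphi px) /pullback_delta dchart_invK//.
under eq_bigr do rewrite mxE.
by under [in leRHS]eq_bigr do under eq_bigr do rewrite !mxE.
Qed.

(** The tolerance is chosen so that by [quadratic_bound] the perturbation is at
    most half of the lower bound; [n%:R + 1] keeps it positive in dimension
    zero. *)
Lemma quadratic_perturbation (a b : 'I_n -> 'I_n -> R) (v : 'I_n -> R) (c : R) :
  0 < c -> (forall i j, `|a i j - b i j| <= c / (2 * (n%:R + 1))) ->
  c * \sum_i v i * v i <= \sum_i \sum_j v i * v j * a i j ->
  c / 2 * \sum_i v i * v i <= \sum_i \sum_j v i * v j * b i j.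
Proof.
move=> c0 ab ca.
have := quadratic_bound v ab.
have -> : \sum_i \sum_j v i * v j * (a i j - b i j) =
    \sum_i \sum_j v i * v j * a i j - \sum_i \sum_j v i * v j * b i j.
  rewrite -sumrB; apply: eq_bigr => i _; rewrite -sumrB.
  by apply: eq_bigr => j _; rewrite mulrBr.
have v0 : 0 <= \sum_i v i * v i.
  by apply: sumr_ge0 => i _; rewrite -expr2 sqr_ge0.
have n1 : 0 < n%:R + 1 :> R by rewrite ltr_wpDl.
have en : c / (2 * (n%:R + 1)) * n%:R <= c / 2.
  rewrite invfM mulrA -mulrA ler_piMr//; first by rewrite divr_ge0// ltW.
  by rewrite ler_pdivrMl// mulr1 lerDl.
rewrite ler_norml => /andP[_ h1]; have h2 := ler_wpM2r v0 en.
set s := \sum_i _ in v0 h1 h2 ca *; lra.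
Qed.

Definition norm_equiv (C : R) g h x := forall u : tangent x,
  fnorm g u <= C * fnorm h u /\ fnorm h u <= C * fnorm g u.

Lemma norm_equiv_sym C g h x : norm_equiv C g h x -> norm_equiv C h g x.
Proof. by move=> gh u; have [] := gh u. Qed.

Lemma norm_equiv_trans C D g h m x : 0 <= C -> 0 <= D ->
  norm_equiv C g h x -> norm_equiv D h m x -> norm_equiv (C * D) g m x.
Proof.
move=> C0 D0 gh hm u; have [g1 g2] := gh u; have [h1 h2] := hm u; split.
  by apply: le_trans g1 _; rewrite -mulrA ler_wpM2l.
by apply: le_trans h2 _; rewrite [C * D]mulrC -mulrA ler_wpM2l.
Qed.

Lemma continuous_dist_near (T : topologicalType) (f : T -> R^o) p (e : R) :
  {for p, continuous f} -> 0 < e -> nbhs p [set q | `|(f p : R) - f q| < e].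
Proof. by move=> /cvgrPdist_lt cf e0; exact: cf. Qed.

Lemma chart_preimage_nbhs psi x (S : set 'rV[R]_n) :
  dom psi x -> nbhs (cmap psi x) S -> nbhs x (cmap psi @^-1` S).
Proof. by move=> sx /(cmap_continuous sx). Qed.

Lemma form_coef_cmap m psi x i j : dom psi x ->
  form_coef m psi i j (cmap psi x) =
  m x (coord_vector psi x i) (coord_vector psi x j).
Proof. by move=> sx; rewrite /form_coef (cmapK sx). Qed.

(** Stated with [form_coef] rather than with the values of the metric on coordinate
    vectors: the coefficients are functions on an open set of R^n, where their
    continuity is known. *)
Lemma smooth_metric_coef_near (W : set M) m psi x (e : R) :
  open W -> W x -> smooth_metric_on W m -> smooth_chart psi -> dom psi x ->
  0 < e -> nbhs x [set y | forall i j,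
    `|form_coef m psi i j (cmap psi x) - form_coef m psi i j (cmap psi y)| < e].
Proof.
move=> oW Wx [_ _ sm] spsi sx e0.
have near_ij i j : nbhs x [set y |
    `|form_coef m psi i j (cmap psi x) - form_coef m psi i j (cmap psi y)| < e].
  have xI : (cmap psi @` (dom psi `&` W)) (cmap psi x) by exists x.
  exact: (chart_preimage_nbhs sx
    (continuous_dist_near (sm psi spsi i j 0%N (cmap psi x) xI) e0)).
have near_i i : nbhs x [set y | forall j,
    `|form_coef m psi i j (cmap psi x) - form_coef m psi i j (cmap psi y)| < e].
  exact: (@filter_forall _ _ (fun j y => `|form_coef m psi i j (cmap psi x) -
    form_coef m psi i j (cmap psi y)| < e) (nbhs x) _ (near_ij i)).
exact: (@filter_forall _ _ (fun i y => forall j,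
  `|form_coef m psi i j (cmap psi x) - form_coef m psi i j (cmap psi y)| < e)
  (nbhs x) _ near_i).
Qed.

(** In the constant, the first summand comes from the bound [S + e] on every
    coefficient at [y], where [S] bounds those of [a] and [e] is the tolerance, and
    [2 / c] comes from [quadratic_perturbation]. *)
Lemma quadratic_norm_equiv m psi y (a : 'I_n -> 'I_n -> R) (c : R) :
  symmetric_bilinear m y -> smooth_chart psi -> dom psi y ->
  0 < c -> (forall v : 'I_n -> R,
    c * \sum_i v i * v i <= \sum_i \sum_j v i * v j * a i j) ->
  (forall i j, `|a i j - m y (coord_vector psi y i) (coord_vector psi y j)| <=
     c / (2 * (n%:R + 1))) ->
  norm_equiv (Num.sqrt ((\sum_i \sum_j `|a i j| + c / (2 * (n%:R + 1))) * n%:R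
    + 2 / c)) m (@pullback_delta R n M psi) y.
Proof.
move=> bm spsi sy c0 ac.
set b := fun i j => m y (coord_vector psi y i) (coord_vector psi y j).
set e := c / _ => ab.
have e0 : 0 < e by rewrite divr_gt0// mulr_gt0// ltr_wpDl.
set S := \sum_i _.
have aS i j : `|a i j| <= S.
  rewrite /S (bigD1 i)//= (bigD1 j)//= -addrA lerDl addr_ge0// ?sumr_ge0//.
  by move=> k _; rewrite sumr_ge0.
have S0 : 0 <= S by rewrite sumr_ge0// => i _; rewrite sumr_ge0.
have c20 : 0 < 2 / c by rewrite divr_gt0.
have D1 : 0 <= (S + e) * n%:R by rewrite mulr_ge0// addr_ge0// ltW.
have D0 : 0 <= (S + e) * n%:R + 2 / c by apply: addr_ge0 => //; exact: ltW.
move=> u; have mE := form_coefE u u bm spsi sy.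
have p0 := pullback_delta_ge0 psi u.
have up : m y u u <= (S + e) * n%:R * pullback_delta psi u u.
  rewrite mE; apply: le_trans (ler_norm _) _.
  apply: (@quadratic_bound b) => i j.
  rewrite -(subKr (a i j) (b i j)); apply: le_trans (ler_normB _ _) _.
  by apply: lerD; [exact: aS|exact: ab].
have low : c / 2 * pullback_delta psi u u <= m y u u.
  by rewrite mE; apply: (@quadratic_perturbation a b).
rewrite /fnorm -!sqrtrM//; split; apply: ler_wsqrtr.
  by apply: le_trans up _; apply: ler_wpM2r => //; rewrite lerDl ltW.
have low' : pullback_delta psi u u <= 2 / c * m y u u.
  have -> : 2 / c = (c / 2)^-1 by rewrite invf_div.
  by rewrite ler_pdivlMl// divr_gt0.
apply: le_trans low' _; apply: ler_wpM2r; last by rewrite lerDr.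
by apply: le_trans low; rewrite mulr_ge0// divr_ge0// ltW.
Qed.

Lemma smooth_metric_local_equiv (W : set M) m psi x :
  open W -> W x -> smooth_metric_on W m -> smooth_chart psi -> dom psi x ->
  exists U (D : R), [/\ open U, U x, 0 <= D &
    forall y, U y -> norm_equiv D m (@pullback_delta R n M psi) y].
Proof.
move=> oW Wx sm spsi sx; have [bm pm _] := sm.
have [c c0 lb] := pos_def_coef_lower_bound (bm x Wx) (pm x Wx) spsi sx.
have e0 : 0 < c / (2 * (n%:R + 1)) by rewrite divr_gt0// mulr_gt0// ltr_wpDl.
have near_x := smooth_metric_coef_near oW Wx sm spsi sx e0.
have : nbhs x (W `&` dom psi).
  apply: open_nbhs_nbhs; split; last by split.
  by apply: openI => //; exact: dom_open.
move=> /(filterI near_x); rewrite nbhsE => -[U [oU Ux] US].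
pose a i j := m x (coord_vector psi x i) (coord_vector psi x j).
exists U, (Num.sqrt ((\sum_i \sum_j `|a i j| + c / (2 * (n%:R + 1))) * n%:R
  + 2 / c)); split=> // y /US[ay [Wy sy]].
apply: (quadratic_norm_equiv (bm y Wy) spsi sy c0 lb) => i j.
by have := ay i j; rewrite (form_coef_cmap _ _ _ sx) (form_coef_cmap _ _ _ sy) => /ltW.
Qed.

End LocalComparison.

(** * Rough metrics are stable under the action *)

Section RoughMetrics.
Context {R : realType} {n : nat} {M : smoothManifold R n}.
Implicit Types (phi psi : chart R n M) (x : M) (g h m : form_section M).
Implicit Types (B : endo_section M).

Section RestrictChart.
Variables (phi : chart R n M) (U : set M) (oU : open U).

Let restrict_img_sub : cmap phi @` (dom phi `&` U) `<=` cmap phi @` dom phi.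
Proof. by apply: image_subset => x []. Qed.

Definition restrict_chart : chart R n M :=
  @Chart R n M (dom phi `&` U) (cmap phi) (cinv phi)
    (openI (@dom_open _ _ _ phi) oU) (chart_img_open (phi := phi) oU)
    (fun x dx => cmapK dx.1)
    (fun x dx => cmap_continuous dx.1)
    (fun p Ip => cinv_continuous (restrict_img_sub Ip)).

Lemma restrict_chart_smooth : smooth_chart phi -> smooth_chart restrict_chart.
Proof.
move=> sphi psi /sphi[ps sp]; split=> k.
  by apply: Ck_on_sub (ps k); apply: image_subset => x [[]].
by apply: Ck_on_sub (sp k); apply: image_subset => x [? []].
Qed.

End RestrictChart.

(** The inverse image of a small closed ball of R^n. *)
Lemma chart_compact_nbhs phi x : dom phi x ->
  exists K : set M, [/\ compact K, K `<=` dom phi & nbhs x K].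
Proof.
move=> px.
have /nbhs_closedballP[e eI] : nbhs (cmap phi x) (cmap phi @` (dom phi `&` setT)).
  exact: chart_img_nbhs openT px I.
have eI' : closed_ball (cmap phi x) e%:num `<=` cmap phi @` dom phi.
  by move=> p /eI[y [py _] <-]; exists y.
exists (cinv phi @` closed_ball (cmap phi x) e%:num); split.
- apply: continuous_compact.
    apply: continuous_in_subspaceT => p /[!inE] /eI'; exact: cinv_continuous.
  apply: bounded_closed_compact; last exact: closed_ball_closed.
  exists (`|cmap phi x| + e%:num); split; first exact: num_real.
  move=> N /ltW eN q. rewrite closed_ballE// /closed_ball_ /= => qe.
  apply: le_trans eN; rewrite -(subKr (cmap phi x) q).
  by apply: le_trans (ler_normB _ _) _; rewrite lerD2l.
- by move=> _ [p /eI'[y py <-] <-]; rewrite cmapK.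
- have ne : nbhs (cmap phi x) (closed_ball (cmap phi x) e%:num).
    exact: filterS (@subset_closed_ball _ _ _ _) (nbhsx_ballx _ _ _).
  have nx : nbhs x (dom phi) := open_nbhs_nbhs (conj (@dom_open _ _ _ phi) px).
  apply: filterS (filterI nx (cmap_continuous px ne)) => y [py /= ey].
  by exists (cmap phi y) => //; rewrite cmapK.
Qed.

(** A rough metric is only compared with the Euclidean metric of some chart, which
    depends on the point and on the metric.  Smooth metrics serve as a common
    reference, both for two rough metrics and for the bounds that define
    [Linfty_loc]. *)
Lemma Met_local_equiv g (W : set M) m x :
  Met g -> open W -> W x -> smooth_metric_on W m ->
  exists U (D : R), [/\ open U, U x, 0 <= D & ae_on U (norm_equiv D g m)].
Proof.
move=> [_ _ locg] oW Wx sm.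
have [psi [C [spsi sx C1 aeC]]] := locg x.
have [U [D [oU Ux D0 mD]]] := smooth_metric_local_equiv oW Wx sm spsi sx.
have C0 : 0 < C by exact: lt_le_trans C1.
exists (U `&` dom psi), (C * D); split=> //.
- by apply: openI => //; exact: dom_open.
- by rewrite mulr_ge0// ltW.
apply: ae_on_impl (ae_on_sub (@subIsetr _ U (dom psi)) aeC) => y [Uy sy] gC.
apply: norm_equiv_trans (norm_equiv_sym (mD y Uy)) => //; first exact: ltW.
by move=> u; have /andP[h1 h2] := gC u; split=> //; rewrite -ler_pdivrMl.
Qed.

(** The chart required at [x] is [chart_at x], restricted to the open set where
    the comparison holds. *)
Lemma Met_of_local_equiv g :
  (forall x, symmetric_bilinear g x) -> measurable_form g ->
  (forall x, exists U (C : R), [/\ open U, U x &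
    ae_on U (norm_equiv C g (@pullback_delta R n M (chart_at x)))]) ->
  Met g.
Proof.
move=> bg mg lg; split=> // x; have [U [C [oU Ux aC]]] := lg x.
pose D := `|C| + 1.
have D1 : 1 <= D by rewrite lerDr.
have D0 : 0 < D by exact: lt_le_trans D1.
have CD : C <= D by rewrite (le_trans (ler_norm C))// lerDl.
exists (restrict_chart (chart_at x) oU), D; split=> //.
- by apply: restrict_chart_smooth; apply: atlas_smooth_chart; exact: chart_at_atlas.
- by split=> //; exact: chart_at_dom.
apply: ae_on_impl (ae_on_sub (@subIsetr _ (dom (chart_at x)) U) aC) => y _ gC u.
have [h1 h2] := gC u; apply/andP; split.
  rewrite ler_pdivrMl//; apply: le_trans h2 _.
  by apply: ler_wpM2r => //; exact: sqrtr_ge0.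
by apply: le_trans h1 _; apply: ler_wpM2r => //; exact: sqrtr_ge0.
Qed.

(** The lower bound for [B] is the upper bound for its inverse, applied to
    [B u]. *)
Lemma Ell_loc_local_bound B x : Ell_loc B ->
  exists U (C : R), [/\ open U, U x, 0 <= C & ae_on U (fun y => forall u : tangent y,
    let m := @pullback_delta R n M (chart_at x) in
    fnorm m (B y u) <= C * fnorm m u /\ fnorm m u <= C * fnorm m (B y u))].
Proof.
move=> [[_ bB] iB [_ bBi]].
have ax := chart_at_dom x; have aa := chart_at_atlas x.
have [K [cK Ka]] := chart_compact_nbhs ax; rewrite nbhsE => -[U [oU Ux] UK].
have sm := pullback_delta_smooth aa.
have [C aC] := bB K cK _ _ (@dom_open _ _ _ _) Ka sm.
have [C' aC'] := bBi K cK _ _ (@dom_open _ _ _ _) Ka sm.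
exists U, (`|C| + `|C'|); split=> //.
apply: ae_on_impl (ae_on_and3 (ae_on_sub UK aC) (ae_on_sub UK aC') (ae_ae_on U iB)).
move=> y _ [hC hC' [_ inv]] u /=; split.
  apply: le_trans (hC u) _; apply: ler_wpM2r; first exact: sqrtr_ge0.
  by rewrite (le_trans (ler_norm C))// lerDl.
have := hC' (B y u).
have -> : endo_inv B y (B y u) = u by rewrite -comp_lfunE inv id_lfunE.
move=> /le_trans; apply; apply: ler_wpM2r; first exact: sqrtr_ge0.
by rewrite (le_trans (ler_norm C'))// lerDr.
Qed.

Lemma eta_bilinear B g x : symmetric_bilinear g x -> symmetric_bilinear (eta B g) x.
Proof.
move=> [sym lin]; split=> [u v|a u v w]; first exact: sym.
by rewrite /eta linearP lin.
Qed.

Lemma Met_eta B g : Ell_loc B -> Met g -> Met (eta B g).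
Proof.
move=> eB Mg; have [bg mg _] := Mg; have [[mB _] _ _] := eB.
apply: Met_of_local_equiv.
- by move=> x; exact: eta_bilinear.
- exact: measurable_eta.
move=> x; have ax := chart_at_dom x; have aa := chart_at_atlas x.
have [U [C [oU Ux C0 aC]]] := Ell_loc_local_bound x eB.
have [V [D [oV Vx D0 aD]]] :=
  Met_local_equiv Mg (@dom_open _ _ _ _) ax (pullback_delta_smooth aa).
exists (U `&` V), (D * C); split=> //; first exact: openI.
apply: ae_on_impl (ae_on_and (ae_on_sub (@subIsetl _ U V) aC)
  (ae_on_sub (@subIsetr _ U V) aD)) => y _ [hC hD] u.
have [c1 c2] := hC u; have [d1 d2] := hD (B y u); split.
  by apply: le_trans d1 _; rewrite -mulrA ler_wpM2l.
apply: le_trans c2 _; rewrite [D * C]mulrC -mulrA; exact: ler_wpM2l.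
Qed.

End RoughMetrics.

(** * A measurable frame and its orthonormalisation *)

Section MeasurableFieldOps.
Context {R : realType} {n : nat} {M : smoothManifold R n}.
Implicit Types (phi psi : chart R n M) (X Y : forall x : M, tangent x).

Lemma measurable_fieldB phi X Y :
  measurable_field_in phi X -> measurable_field_in phi Y ->
  measurable_field_in phi (fun x => X x - Y x).
Proof.
move=> mX mY j; apply: measurable_scalar_ext (_ : measurable_scalar_in phi
  (fun x => dchart phi (X x) 0 j + -1 * dchart phi (Y x) 0 j)).
  by move=> x _; rewrite linearB !mxE mulN1r.
apply: lebesgue_measurableD; first exact: mX.
by apply: lebesgue_measurableM; [exact: measurable_cst|exact: mY].
Qed.

Lemma measurable_fieldZ phi (f : M -> R) X :
  measurable_scalar_in phi f -> measurable_field_in phi X ->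
  measurable_field_in phi (fun x => f x *: X x).
Proof.
move=> mf mX j; apply: measurable_scalar_ext (_ : measurable_scalar_in phi
  (fun x => f x * dchart phi (X x) 0 j)).
  by move=> x _; rewrite linearZ mxE.
by apply: lebesgue_measurableM; [exact: mf|exact: mX].
Qed.

Lemma measurable_field_sum phi (I : Type) (r : seq I)
    (X : I -> forall x : M, tangent x) :
  (forall i, measurable_field_in phi (X i)) ->
  measurable_field_in phi (fun x => \sum_(i <- r) X i x).
Proof.
move=> mX j; apply: measurable_scalar_ext (_ : measurable_scalar_in phi
  (fun x => \sum_(i <- r) dchart phi (X i x) 0 j)).
  by move=> x _; rewrite linear_sum summxE.
by apply: lebesgue_measurable_sum => i; exact: mX.
Qed.

Lemma measurable_scalar_powR phi (f : M -> R) (a : R) :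
  measurable_scalar_in phi f -> measurable_scalar_in phi (fun x => f x `^ a).
Proof.
move=> mf; rewrite /measurable_scalar_in.
exact: (measurableT_comp (measurable_powR a) mf).
Qed.

Lemma gram_schmidt_measurable (g : form_section M)
    (e : nat -> forall x : M, tangent x) phi k i :
  smooth_chart phi -> (forall x, symmetric_bilinear g x) -> measurable_form g ->
  (forall i, measurable_field_in phi (e i)) ->
  measurable_field_in phi (fun x => gram_schmidt (g x) (fun i => e i x) k i).
Proof.
move=> sphi bg mg me; elim: k i => [|k IH] i.
  move=> j; apply: measurable_scalar_ext (_ : measurable_scalar_in phi (fun=> 0)).
    by move=> x _ /=; rewrite linear0 mxE.
  exact: measurable_cst.
rewrite /=; case: (i == k); last exact: IH.
set s := fun x : M => e k x - \sum_(j < k)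
  g x (e k x) (gram_schmidt (g x) (fun i => e i x) k j) *:
    gram_schmidt (g x) (fun i => e i x) k j.
have ms : measurable_field_in phi s.
  apply: measurable_fieldB; first exact: me.
  apply: measurable_field_sum => j; apply: measurable_fieldZ; last exact: IH.
  exact: form_apply_measurable (me k) (IH j).
apply: (measurable_fieldZ _ ms); apply: measurable_scalar_powR.
exact: form_apply_measurable.
Qed.

Lemma dchart_frame_vectorE (c phi : chart R n M) x i :
  smooth_chart c -> smooth_chart phi -> dom c x -> dom phi x ->
  dchart phi (frame_vector c x i) =
  'D_(\row_j (i == j)%:R) (cmap phi \o cinv c) (cmap c x).
Proof. exact: dchart_dchart_inv. Qed.

(** The derivative of the transition map from [c] to [phi], read at the
    coordinates in [c] of the point with coordinates [q] in [phi].  The change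
    of variables is applied to a continuous function: precomposing a Lebesgue
    measurable one would require it to preserve null sets. *)
Lemma transition_derive_continuous (c phi : chart R n M) (w : 'rV[R]_n) x :
  atlas c -> smooth_chart phi -> dom phi x -> dom c x ->
  {for cmap phi x, continuous
    (('D_w (cmap phi \o cinv c)) \o (cmap c \o cinv phi))}.
Proof.
move=> ac sphi px cx.
have cD : {for cmap c x, continuous ('D_w (cmap phi \o cinv c))}.
  have [_ /(_ 1)[_ /(_ w)]] := sphi c ac; apply.
  by exists x.
have cinvx : {for cmap phi x, continuous (cinv phi)}.
  by apply: cinv_continuous; exists x.
have cc : {for cinv phi (cmap phi x), continuous (cmap c)}.
  by rewrite (cmapK px); exact: cmap_continuous.
apply: continuous_comp; first exact: continuous_comp.
by rewrite /= (cmapK px).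
Qed.

Lemma frame_vector_measurable (c phi : chart R n M) i j :
  atlas c -> smooth_chart phi ->
  lebesgue_measurable_fun (cmap phi @` (dom phi `&` dom c))
    (fun p => dchart phi (frame_vector c (cinv phi p) i) 0 j).
Proof.
move=> ac sphi; have sc := atlas_smooth_chart ac.
pose w : 'rV[R]_n := \row_j (i == j)%:R.
apply: (@lebesgue_measurable_ext _ _ _ (fun q =>
    (('D_w (cmap phi \o cinv c)) \o (cmap c \o cinv phi)) q 0 j)).
  move=> _ [x [px cx] <-]; rewrite [in RHS](cmapK px).
  by rewrite (dchart_frame_vectorE i sc sphi cx px) [in LHS]/= (cmapK px).
apply: lebesgue_measurable_continuous.
  by apply: chart_img_open; exact: dom_open.
move=> _ [x [px cx] <-].
apply: (@continuous_comp _ _ _ (('D_w (cmap phi \o cinv c)) \o (cmap c \o cinv phi))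
  (fun v : 'rV[R]_n => v 0 j)); last exact: coord_continuous.
exact: transition_derive_continuous.
Qed.

(** Countably many atlas charts cover [M]; at each point use the coordinate
    frame of the first chart of the list that contains it.  In a given chart
    [phi] the regions where a fixed chart is selected are differences of open
    sets, and on each of them the frame is continuous. *)
Lemma measurable_frame : exists c : M -> chart R n M,
  (forall x, atlas (c x) /\ dom (c x) x) /\
  forall phi i, smooth_chart phi ->
    measurable_field_in phi (fun x => frame_vector (c x) x i).
Proof.
have [[x0 _]|M0] := pselect (exists x : M, True); last first.
  (* The sequence of charts below needs a point; on an empty manifold every
     chart has an empty image. *)
  exists (@chart_at R n M); split.
    by move=> x; split; [exact: chart_at_atlas|exact: chart_at_dom].
  move=> phi i _ j; rewrite /measurable_scalar_in.
  rewrite (_ : cmap phi @` dom phi = set0); first exact: measurable_fun_set0.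
  by rewrite -subset0 => p [x _ _]; exfalso; apply: M0; exists x.
have [s sP] := second_countable_subcover (carrier_second_countable M)
  (fun x => @dom_open _ _ _ (chart_at x)) (@chart_at_dom R n M) x0.
pose c k := chart_at (s k).
have sP' x : exists k, `[< dom (c k) x >].
  by have [k sk] := sP x; exists k; apply/asboolP.
pose N x := ex_minn (sP' x).
have NP x : dom (c (N x)) x by rewrite /N; case: ex_minnP => k /asboolP.
have Nmin x k : dom (c k) x -> (N x <= k)%N.
  by move=> ck; rewrite /N; case: ex_minnP => l _; apply; exact/asboolP.
exists (fun x => c (N x)); split.
  by move=> x; split=> //; exact: chart_at_atlas.
move=> phi i sphi j.
pose A k := cmap phi @` (dom phi `&` dom (c k)).
have oA k : open (A k) by apply: chart_img_open; exact: dom_open.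
have mA k := lebesgue_measurable_open (oA k).
pose E k := A k `\` \bigcup_(l in [set l | (l < k)%N]) A l.
have mE k : measurable (E k : set (g_sigma_algebraType (@lebesgue_gen R n))).
  by apply: measurableD => //; apply: bigcup_measurable => l _; exact: mA.
have EN p k : E k p -> (cmap phi @` dom phi) p /\ N (cinv phi p) = k.
  move=> [[x [px cx] <-] nA]; split; first by exists x.
  rewrite (cmapK px); apply/eqP; rewrite eqn_leq Nmin// leqNgt; apply/negP => Nk.
  by apply: nA; exists (N x) => //; exists x.
have DE : cmap phi @` dom phi = \bigcup_k E k.
  rewrite eqEsubset; split=> [_ [x px <-]|p [k _ /EN[]//]].
  exists (N x) => //; split; first by exists x.
  move=> [l /= lN [y [py cy] xy]]; have yx : y = x.
    by rewrite -(cmapK py) xy (cmapK px).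
  by move: lN; rewrite ltnNge Nmin// -yx.
rewrite /measurable_scalar_in /lebesgue_measurable_fun DE.
apply/(measurable_fun_bigcup _ mE) => k.
apply: (@lebesgue_measurable_ext _ _ _ (fun p =>
  dchart phi (frame_vector (c k) (cinv phi p) i) 0 j)).
  by move=> p /EN[_ /= ->].
apply: (@measurable_funS _ _ (g_sigma_algebraType (@lebesgue_gen R n)) _ (A k)) => //.
  by move=> p [].
by apply: frame_vector_measurable => //; exact: chart_at_atlas.
Qed.

End MeasurableFieldOps.

(** * Transitivity of the action *)

Section Transitivity.
Context {R : realType} {n : nat} {M : smoothManifold R n}.
Implicit Types (phi psi : chart R n M) (x : M) (g h m : form_section M).

Section Transport.
Variable c : M -> chart R n M.
Hypothesis c_atlas : forall x, atlas (c x).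
Hypothesis c_dom : forall x, dom (c x) x.

Definition gs_frame g (i : 'I_n) x : tangent x :=
  gram_schmidt (g x) (frame_vector (c x) x) n i.

(** The endomorphism that sends the [g]-orthonormal frame to the [h]-orthonormal
    one, written with the scalar products of [g] so that no matrix has to be
    inverted. *)
Definition frame_transport g h : endo_section M := fun x =>
  linfun (fun u : tangent x => \sum_i g x u (gs_frame g i x) *: gs_frame h i x).

Lemma frame_transportE g h x (u : tangent x) : symmetric_bilinear g x ->
  frame_transport g h x u = \sum_i g x u (gs_frame g i x) *: gs_frame h i x.
Proof.
move=> bg; pose F (u : tangent x) : tangent x :=
  \sum_i g x u (gs_frame g i x) *: gs_frame h i x.
have linF : linear F.
  move=> a v w; rewrite /F scaler_sumr -big_split; apply: eq_bigr => i _ /=.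
  by rewrite ![g x _ (gs_frame g i x)]bg.1 bg.2 scalerDl scalerA.
pose FL : {linear tangent x -> tangent x} :=
  HB.pack F (GRing.isLinear.Build R (tangent x) (tangent x) _ F linF).
exact: (lfunE FL u).
Qed.

Lemma gs_frame_orthonormal g x i j : symmetric_bilinear g x -> pos_def g x ->
  g x (gs_frame g i x) (gs_frame g j x) = (i == j)%:R.
Proof.
move=> bg pg; have sc := atlas_smooth_chart (c_atlas x).
have [on _] := gram_schmidt_orthonormal bg pg sc (c_dom x) (leqnn n).
exact: on.
Qed.

Lemma gs_frame_expansion g x (u : tangent x) :
  symmetric_bilinear g x -> pos_def g x ->
  u = \sum_i g x u (gs_frame g i x) *: gs_frame g i x.
Proof.
move=> bg pg; have sc := atlas_smooth_chart (c_atlas x).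
apply: (orthonormal_expansion u bg sc (c_dom x)) => i j.
exact: gs_frame_orthonormal.
Qed.

(** [frame_transport g h] preserves coordinates with respect to the two frames;
    that it is an isometry and that exchanging [g] and [h] inverts it both
    follow. *)
Lemma frame_transport_coord g h x (u : tangent x) j :
  symmetric_bilinear g x -> symmetric_bilinear h x -> pos_def h x ->
  h x (frame_transport g h x u) (gs_frame h j x) = g x u (gs_frame g j x).
Proof.
move=> bg bh ph; rewrite frame_transportE// form_suml// (bigD1 j)//= big1.
  by rewrite gs_frame_orthonormal// eqxx mulr1 addr0.
by move=> i ij; rewrite gs_frame_orthonormal// (negPf ij) mulr0.
Qed.

Lemma frame_transport_isometry g h x (u v : tangent x) :
  symmetric_bilinear g x -> symmetric_bilinear h x ->
  pos_def g x -> pos_def h x ->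
  h x (frame_transport g h x u) (frame_transport g h x v) = g x u v.
Proof.
move=> bg bh pg ph.
rewrite (orthonormal_parseval _ bh (gs_frame_expansion _ bh ph)).
rewrite (orthonormal_parseval v bg (gs_frame_expansion u bg pg)).
by apply: eq_bigr => i _; rewrite !frame_transport_coord.
Qed.

Lemma frame_transportK g h x :
  symmetric_bilinear g x -> symmetric_bilinear h x ->
  pos_def g x -> pos_def h x ->
  (frame_transport h g x \o frame_transport g h x = \1)%VF.
Proof.
move=> bg bh pg ph; apply/lfunP => u; rewrite comp_lfunE id_lfunE.
rewrite frame_transportE// [RHS](gs_frame_expansion u bg pg).
by apply: eq_bigr => i _; rewrite frame_transport_coord.
Qed.

Hypothesis c_measurable : forall phi i, smooth_chart phi ->
  measurable_field_in phi (fun x => frame_vector (c x) x i).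

Lemma frame_transport_measurable g h :
  (forall x, symmetric_bilinear g x) -> (forall x, symmetric_bilinear h x) ->
  measurable_form g -> measurable_form h ->
  measurable_endo (frame_transport g h).
Proof.
move=> bg bh mg mh phi sphi i.
have mframe f k : (forall x, symmetric_bilinear f x) -> measurable_form f ->
    measurable_field_in phi (gs_frame f k).
  move=> bf mf; apply: (gram_schmidt_measurable
    (e := fun i x => frame_vector (c x) x i)) => // l; exact: c_measurable.
suff H : measurable_field_in phi (fun x =>
  frame_transport g h x (coord_vector phi x i)) by exact: H.
have mF : measurable_field_in phi (fun x => \sum_k
    g x (coord_vector phi x i) (gs_frame g k x) *: gs_frame h k x).
  apply: measurable_field_sum => k; apply: measurable_fieldZ; last exact: mframe.
  apply: form_apply_measurable => //; last exact: mframe.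
  exact: coord_vector_measurable.
move=> j; apply: measurable_scalar_ext (mF j) => x _.
by rewrite frame_transportE.
Qed.

End Transport.

Lemma Met_pos_def g : Met g -> ae (fun x : M => pos_def g x).
Proof.
move=> [_ _ lg]; apply: ae_local => x; have [psi [C [spsi sx C1 aC]]] := lg x.
exists (dom psi); split=> //; first exact: dom_open.
apply: ae_on_impl aC => y sy hC u u0; have /andP[lb _] := hC u.
have C0 : 0 < C by exact: lt_le_trans C1.
rewrite -sqrtr_gt0; apply: lt_le_trans lb.
by rewrite mulr_gt0 ?invr_gt0// sqrtr_gt0; exact: pullback_delta_gt0.
Qed.

(** Near a point, with respect to a smooth metric [m], the norm of [B u] is
    comparable with its [h]-norm, which equals the [g]-norm of [u], which is
    comparable with the [m]-norm of [u]. *)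
Lemma isometry_Linfty_loc g h (B : endo_section M) :
  Met g -> Met h -> measurable_endo B ->
  ae (fun x : M => forall u, h x (B x u) (B x u) = g x u u) -> Linfty_loc B.
Proof.
move=> Mg Mh mB iso; split=> // K cK W m oW KW sm.
pose P (A : set M) := exists2 C : R, 0 <= C &
  ae_on A (fun x => forall u : tangent x, fnorm m (B x u) <= C * fnorm m u).
suff: P K by move=> [C _ aC]; exists C.
apply: (compact_ideal cK).
- by exists 0 => //; exact: ae_onT.
- by move=> A A' AA' [C C0 aC]; exists C => //; exact: ae_on_sub aC.
- move=> A A' [C C0 aC] [D D0 aD]; exists (C + D); first exact: addr_ge0.
  apply: ae_on_setU.
    apply: ae_on_impl aC => x _ hC u; apply: le_trans (hC u) _.
    by apply: ler_wpM2r; [exact: sqrtr_ge0|rewrite lerDl].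
  apply: ae_on_impl aD => x _ hD u; apply: le_trans (hD u) _.
  by apply: ler_wpM2r; [exact: sqrtr_ge0|rewrite lerDr].
move=> x Kx; have Wx := KW x Kx.
have [U [C [oU Ux C0 aC]]] := Met_local_equiv Mg oW Wx sm.
have [V [D [oV Vx D0 aD]]] := Met_local_equiv Mh oW Wx sm.
exists (U `&` V); first by apply: open_nbhs_nbhs; split=> //; exact: openI.
exists (D * C); first exact: mulr_ge0.
apply: ae_on_impl (ae_on_and3 (ae_on_sub (@subIsetl _ U V) aC)
  (ae_on_sub (@subIsetr _ U V) aD) (ae_ae_on (U `&` V) iso)) => y _ [hC hD hB] u.
have [_ h1] := hD (B y u); apply: le_trans h1 _.
rewrite -mulrA; apply: ler_wpM2l => //.
by rewrite {1}/fnorm hB; have [] := hC u.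
Qed.

Lemma Met_transitive g h : Met g -> Met h ->
  exists B : endo_section M, Ell_loc B /\ form_ae_eq g (eta B h).
Proof.
move=> Mg Mh; have [bg mg _] := Mg; have [bh mh _] := Mh.
have [c [cP mc]] := @measurable_frame R n M.
have ca x : atlas (c x) by have [] := cP x.
have cd x : dom (c x) x by have [] := cP x.
have pgh := ae_on_and (Met_pos_def Mg) (Met_pos_def Mh).
exists (frame_transport c g h); split; last first.
  apply: ae_on_impl pgh => x _ [pg ph] u v.
  by rewrite /eta frame_transport_isometry.
apply: (@Ell_loc_inverse _ _ _ _ (frame_transport c h g)).
- apply: (isometry_Linfty_loc Mg Mh); first exact: frame_transport_measurable.
  by apply: ae_on_impl pgh => x _ [pg ph] u; rewrite frame_transport_isometry.
- apply: (isometry_Linfty_loc Mh Mg); first exact: frame_transport_measurable.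
  by apply: ae_on_impl pgh => x _ [pg ph] u; rewrite frame_transport_isometry.
- by apply: ae_on_impl pgh => x _ [pg ph]; split; apply: frame_transportK.
Qed.

End Transitivity.

Theorem theorem2p8 (R : realType) (n : nat) (M : smoothManifold R n)
    (M_connected : connected [set: M]) :
  [/\ forall (B : endo_section M) (g : form_section M),
        Ell_loc B -> Met g -> Met (eta B g),
      is_group_action_mod (@Ell_loc R n M) (@endo_ae_eq R n M)
        (@endo_comp R n M) (@endo_one R n M) (@endo_inv R n M)
        (@Met R n M) (@form_ae_eq R n M) (@eta R n M) &
      forall g h : form_section M, Met g -> Met h ->
        exists B : endo_section M, Ell_loc B /\ form_ae_eq g (eta B h)].
Proof.
split; [exact: Met_eta| |exact: Met_transitive].
split.
- exact: Ell_loc_group.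
- exact: form_ae_equiv.
- exact: Met_eta.
- move=> B B' g g' _ _ _ _ BB gg; apply: ae_on_impl (ae_on_and BB gg).
  by move=> x _ [Bx gx] u v; rewrite /eta Bx gx.
- by move=> g _; apply: ae_onT => x _ u v; rewrite /eta /endo_one !id_lfunE.
- by move=> A B g _ _ _; apply: ae_onT => x _ u v; rewrite /eta /endo_comp !comp_lfunE.
Qed.
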